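(* Let $\mathbb{K}$ be an algebraically closed field of characteristic zero, $T\cong(\mathbb{K}^\times)^r$ a torus with Lie algebra $\mathfrak t$, and $V=\bigoplus_{i=1}^n V_i$ an $n$-dimensional $T$-module with $V_i\cong\mathbb K$ of weight $s_i=(s_i^1,\dots,s_i^r)\in X^*(T)\cong\mathbb Z^r$. Let $S=(s_i^j)$ be the $n\times r$ weight matrix, and for $I\subseteq\{1,\dots,n\}$ let $S_I$ be the submatrix of rows indexed by $I$ and $S_{\hat\imath}:=S_{\{1,\dots,n\}\setminus\{i\}}$. Let $\mu:V\oplus V^*\to\mathfrak t^*$, $\mu(x,\varphi)(\xi)=\varphi(\xi\cdot x)$. Then: (i) $\mu^{-1}(0)$ is a reduced complete intersection of dimension $2\dim V-\operatorname{rk}S$; (ii) the irreducible components of $\mu^{-1}(0)$ are exactly the sets $\overline{\mu^{-1}(0)_{J_I}}$ with $\operatorname{rk}S-\operatorname{rk}S_I=n-\#I$; (iii) $\mu^{-1}(0)$ is irreducible if and only if $\operatorname{rk}S_{\hat\imath}=\operatorname{rk}S$ for every $i\in\{1,\dots,n\}$; (iv) $\mu^{-1}(0)$ is normal if and only if it is irreducible.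
   Context: For $I\subseteq\{1,\dots,n\}$, $J_I:=\{(v_i)_i\in V\mid v_i\neq0\Leftrightarrow i\in I\}$, and $\mu^{-1}(0)_{J_I}:=\{(x,\varphi)\in J_I\times V^*\mid \varphi\in(\mathfrak t\cdot x)^\perp\}$. *)

(* Defs.v *)
From HB Require Import structures.
From mathcomp Require Import all_boot all_order all_algebra.
From mathcomp Require Import mpoly.
Set Implicit Arguments.
Unset Strict Implicit.
Unset Printing Implicit Defensive.
Import Order.TTheory GRing.Theory Num.Theory.
Local Open Scope ring_scope.

Section Affine.
Variables (K : fieldType) (N : nat).
Definition pt := 'I_N -> K.
Definition pset := pt -> Prop.
Definition psub (A B : pset) := forall v, A v -> B v.

Definition in_ideal (m : nat) (f : 'I_m -> {mpoly K[N]}) (p : {mpoly K[N]}) :=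
  exists c : 'I_m -> {mpoly K[N]}, p = \sum_(i < m) c i * f i.

Definition radical_ideal (m : nat) (f : 'I_m -> {mpoly K[N]}) :=
  forall (p : {mpoly K[N]}) (k : nat), in_ideal f (p ^+ k) -> in_ideal f p.

Definition same_ideal (m m' : nat) (f : 'I_m -> {mpoly K[N]})
    (g : 'I_m' -> {mpoly K[N]}) :=
  (forall i, in_ideal g (f i)) /\ (forall i, in_ideal f (g i)).

Definition zeroset (m : nat) (f : 'I_m -> {mpoly K[N]}) : pset :=
  fun v => forall i, (f i).@[v] = 0.

Definition zclosed (C : pset) :=
  exists P : {mpoly K[N]} -> Prop,
    forall v, C v <-> (forall p, P p -> p.@[v] = 0).

Definition zclosure (A : pset) : pset :=
  fun v => forall C, zclosed C -> psub A C -> C v.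

Definition irreducible (Y : pset) :=
  (exists v, Y v) /\
  forall C1 C2, zclosed C1 -> zclosed C2 ->
    psub Y (fun v => C1 v \/ C2 v) -> psub Y C1 \/ psub Y C2.

Definition irr_component (Z Y : pset) :=
  irreducible Y /\ psub Y Z /\
  forall Y', irreducible Y' -> psub Y' Z -> psub Y Y' -> psub Y' Y.

Definition has_chain (Z : pset) (k : nat) :=
  exists Y : nat -> pset,
    (forall i, (i <= k)%N -> [/\ zclosed (Y i), irreducible (Y i) & psub (Y i) Z])
    /\ (forall i, (i < k)%N -> psub (Y i) (Y i.+1) /\ ~ psub (Y i.+1) (Y i)).

Definition dimension (Z : pset) (d : nat) :=
  has_chain Z d /\ forall k, has_chain Z k -> (k <= d)%N.

Definition complete_intersection (m : nat) (f : 'I_m -> {mpoly K[N]}) :=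
  exists d c, dimension (zeroset f) d /\ (d + c = N)%N /\
    exists g : 'I_c -> {mpoly K[N]}, same_ideal f g.

(* normality at a point p of the scheme Spec K[X]/(f): the local ring
   (K[X]/(f))_{m_p} is an integrally closed domain, written out in terms of
   representatives (elements w with w(p) != 0 are the units outside m_p) *)
Definition zero_at (m : nat) (f : 'I_m -> {mpoly K[N]}) (p : pt) (a : {mpoly K[N]}) :=
  exists w : {mpoly K[N]}, w.@[p] != 0 /\ in_ideal f (w * a).

Definition normal_at (m : nat) (f : 'I_m -> {mpoly K[N]}) (p : pt) :=
  (forall a b, zero_at f p (a * b) -> zero_at f p a \/ zero_at f p b) /\
  (forall (a b s : {mpoly K[N]}) (d : nat) (c : nat -> {mpoly K[N]}),
     ~ zero_at f p b -> s.@[p] != 0 ->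
     in_ideal f (s * a ^+ d + \sum_(k < d) c k * a ^+ k * b ^+ (d - k)) ->
     exists e t : {mpoly K[N]}, t.@[p] != 0 /\ zero_at f p (t * a - b * e)).

Definition normal_scheme (m : nat) (f : 'I_m -> {mpoly K[N]}) :=
  forall p, zeroset f p -> normal_at f p.
End Affine.

(* The moment map setting: coordinates x_1..x_n on V (indices lshift n i)
   and dual coordinates phi_1..phi_n on V^* (indices rshift n i). *)
Section Moment.
Variables (K : fieldType) (n r : nat) (S : 'M[int]_(n, r)).

Definition SK : 'M[K]_(n, r) := map_mx (fun z : int => z%:~R) S.

Definition rk_rows (I : {set 'I_n}) : nat :=
  \rank (rowsub (fun k : 'I_#|I| => enum_val k) SK).

Definition mu_comp : 'I_r -> {mpoly K[n + n]} :=
  fun j => \sum_(i < n) (S i j)%:~R *: ('X_(lshift n i) * 'X_(rshift n i)).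

Definition mu0 : pset K (n + n) := zeroset mu_comp.

Definition mu0_J (I : {set 'I_n}) : pset K (n + n) :=
  fun v => mu0 v /\ forall i : 'I_n, (v (lshift n i) != 0) = (i \in I).
End Moment.

Arguments SK K {n r} S.
Arguments rk_rows K {n r} S I.
Arguments mu_comp K {n r} S.
Arguments mu0 K {n r} S.
Arguments mu0_J K {n r} S I.

(* Main.v *)
(* Let m be the dimension of the left kernel of S and lam_1, ..., lam_n the
   restrictions to it of the coordinates of K^n. Every set I of indices gives a
   map from the affine space with coordinates z_1, ..., z_n, t_1, ..., t_m into
   the zero fibre: put x_i = z_i, y_i = lam_i(t) prod_(j != i) z_j for i in I,
   and exchange x_i and y_i for the other i. The map is homogeneous for the
   Z^n-grading in which x_i and y_i have opposite weights, the components of a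
   polynomial are of the form X^k q(x_1 y_1, ..., x_n y_n), and q(xy) lies in the
   ideal as soon as q vanishes on the kernel. Hence a polynomial killed by enough
   of these charts lies in the ideal. This gives reducedness and the components,
   which are the closures of the charts with lam_i = 0 for all i outside I. Chains
   of irreducible closed sets are bounded by algebraic dependence of n + m + 1
   polynomials in n + m variables.
   If no lam_i is zero, each single chart is injective on the coordinate ring and
   becomes an isomorphism after inverting one variable of every pair {x_i, y_i}.
   Polynomial rings are integrally closed, so an integral fraction becomes regular
   after each of these localizations, hence is regular because the sequences
   x_i, y_i are regular. *)
Require Import Defs.
From HB Require Import structures.
From mathcomp Require Import all_boot all_order all_algebra.
From mathcomp Require Import mpoly.
From mathcomp Require Import ring zify.
From Stdlib Require Import Classical FunctionalExtensionality.
Set Implicit Arguments.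
Unset Strict Implicit.
Unset Printing Implicit Defensive.
Import Order.TTheory GRing.Theory Num.Theory.
Local Open Scope ring_scope.

(** * Complete integral closure of polynomial rings *)

(** Almost integrality of the fraction a / b: all its powers have the common denominator c. This
    condition, unlike the integral equation itself, passes easily to polynomial rings. *)
Definition completely_integrally_closed (R : idomainType) :=
  forall a b c : R, c != 0 ->
    (forall k, exists e, c * a ^+ k = b ^+ k * e) -> exists e, a = b * e.

Section CompleteIntegralClosure.
Variable R : idomainType.
Implicit Types f g c : {poly R}.

(** [%|] is divisibility up to nonzero scalars. After division by the gcd the cofactor of g is
    coprime to that of f, so all its powers divide c; comparing degrees, it is constant. *)
Lemma dvdp_of_dvdp_exp f g c : c != 0 ->
  (forall k, g ^+ k %| c * f ^+ k) -> g %| f.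
Proof.
move=> nzc dv.
have [g0|nzg] := eqVneq g 0.
  move: (dv 1%N); rewrite !expr1 g0 !dvd0p mulf_eq0 (negbTE nzc) /=.
  by [].
have nzh : gcdp f g != 0 by rewrite gcdp_eq0 negb_and nzg orbT.
have cop := coprimep_div_gcd (introT orP (or_intror nzg) : (f != 0) || (g != 0)).
set h := gcdp f g in nzh cop.
have Ef := Pdiv.Idomain.divpK (dvdp_gcdl f g).
have Eg := Pdiv.Idomain.divpK (dvdp_gcdr f g).
rewrite -/h in Ef Eg.
set f' : {poly R} := f %/ h in cop Ef; set g' : {poly R} := g %/ h in cop Eg.
have nza k : lead_coef h ^+ k != 0 by rewrite expf_neq0 // lead_coef_eq0.
have dv' k : g' ^+ k %| c.
  rewrite -(@Gauss_dvdpl _ _ (f' ^+ k)); last first.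
    by rewrite coprimep_expl // coprimep_expr // coprimep_sym.
  rewrite -(dvdp_mul2r _ _ (expf_neq0 k nzh)) -mulrA -!exprMn Ef Eg.
  by rewrite !exprZn -scalerAr Pdiv.Idomain.dvdpZl ?Pdiv.Idomain.dvdpZr
             ?expf_neq0 ?lead_coef_eq0.
have nzg' : g' != 0.
  apply: contraNneq nzg => g'0; move/eqP: Eg; rewrite g'0 mul0r eq_sym scale_poly_eq0.
  by rewrite (negbTE (nza _)).
have sg' : size g' = 1%N.
  move: (dvdp_leq nzc (dv' (size c))).
  have : (0 < size g')%N by rewrite size_poly_gt0.
  move: (size_exp g' (size c)); have := size_poly_gt0 c; rewrite nzc.
  by case: (size g') => [|[|s]] //=; move: (size (g' ^+ _)); lia.
have /size_poly1P [u nzu g'E] : size g' == 1%N by rewrite sg'.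
have : g %| h.
  by rewrite -(Pdiv.Idomain.dvdpZl _ _ (nza (scalp g h))) -Eg g'E mul_polyC Pdiv.Idomain.dvdpZl.
by move=> /dvdp_trans; apply; apply: dvdp_gcdl.
Qed.

Hypothesis cicR : completely_integrally_closed R.

(** Leading coefficients reduce divisibility by [al] to the hypothesis on R. The leading term is
    then subtracted, and the binomial formula shows that the remainder inherits the assumption. *)
Lemma scalar_dvdp_of_exp (al : R) c : al != 0 -> c != 0 ->
  forall q : {poly R}, (forall k, exists e : {poly R}, c * q ^+ k = al ^+ k *: e) ->
  exists e : {poly R}, q = al *: e.
Proof.
move=> nzal nzc q; have [s] := ubnP (size q).
elim: s q => // s IH q sq H.
have [->|nzq] := eqVneq q 0; first by exists 0; rewrite scaler0.
have [b lb] : exists b, lead_coef q = al * b.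
  apply: (cicR (c := lead_coef c)); first by rewrite lead_coef_eq0.
  move=> k; have [e He] := H k.
  exists (lead_coef e); rewrite -lead_coefZ -He lead_coefM.
  by congr (_ * _); elim: k {He H} => [|k IHk]; rewrite ?lead_coef1 // !exprS lead_coefM IHk.
pose q1 := q - al *: (b *: 'X^((size q).-1)).
have sq1 : (size q1 < size q)%N.
  have sle : (size q1 <= size q)%N.
    rewrite (leq_trans (size_polyD _ _)) // geq_max leqnn size_polyN.
    rewrite scalerA (leq_trans (size_scale_leq _ _)) // size_polyXn.
    by rewrite prednK // size_poly_gt0.
  move: sle; rewrite leq_eqVlt => /orP[/eqP sE|//].
  have : lead_coef q1 = 0.
    rewrite lead_coefE sE coefB !coefZ coefXn eqxx mulr1 -lb lead_coefE subrr //.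
  move/eqP; rewrite lead_coef_eq0 -size_poly_eq0 sE size_poly_eq0.
  by rewrite (negbTE nzq).
have [|k|e e1] := IH q1.
- by rewrite (leq_trans sq1) // -ltnS.
- rewrite /q1 -scalerN exprDn big_distrr /=.
  apply: (big_ind (fun x => exists e : {poly R}, x = al ^+ k *: e)) => [||i _].
  + by exists 0; rewrite scaler0.
  + by move=> _ _ [e1 ->] [e2 ->]; exists (e1 + e2); rewrite scalerDr.
  + have [e He] := H (k - i)%N.
    exists ((e * (- (b *: 'X^((size q).-1))) ^+ i) *+ 'C(k, i)).
    rewrite mulrnAr -[RHS]scalerMnr; congr (_ *+ _).
    rewrite mulrA He exprZn -scalerAl -scalerAr scalerA -exprD.
    by rewrite subnK // -ltnS.
- exists (e + b *: 'X^((size q).-1)).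
  by rewrite scalerDr -e1 subrK.
Qed.

Lemma poly_cic : completely_integrally_closed {poly R}.
Proof.
move=> f g c nzc H.
have [g0|nzg] := eqVneq g 0.
  have [e] := H 1%N; rewrite !expr1 g0 mul0r => /eqP; rewrite mulf_eq0 (negbTE nzc) /=.
  by move=> /eqP->; exists 0; rewrite mulr0.
have : g %| f.
  apply: (dvdp_of_dvdp_exp nzc) => k; have [e ->] := H k.
  exact: dvdp_mulIl.
(* Pseudo-division gives [al *: f = q * g]; it remains to divide q by the scalar [al]. *)
case/Pdiv.Idomain.dvdpP => -[al q] /= nzal fE.
have [k|e qE] := @scalar_dvdp_of_exp al c nzal nzc q.
  have [e He] := H k; exists e.
  apply: (mulIf (expf_neq0 k nzg)).
  by rewrite -mulrA -exprMn -fE exprZn -scalerAr He -scalerAl [e * _]mulrC.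
exists e; have nzP : al%:P != 0 by rewrite polyC_eq0.
by apply: (mulfI nzP); rewrite !mul_polyC fE qE -scalerAl mulrC.
Qed.
End CompleteIntegralClosure.

(** A monic equation of degree d makes b^d a common denominator of all powers of a / b: for k at
    least d, substituting the equation expresses a^k by lower powers. *)
Lemma integral_dvd (R : idomainType) (cicR : completely_integrally_closed R)
    (a b : R) (d : nat) (c : nat -> R) :
  b != 0 -> a ^+ d + \sum_(k < d) c k * a ^+ k * b ^+ (d - k) = 0 ->
  exists e, a = b * e.
Proof.
move=> nzb rel; apply: (cicR a b (b ^+ d) (expf_neq0 _ nzb)) => k.
have [s] := ubnP k; elim: s k => // s IH k; rewrite ltnS => ks.
have [ltkd|ledk] := ltnP k d.
  by exists (b ^+ (d - k) * a ^+ k); rewrite mulrA -exprD subnKC // ltnW.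
have -> : a ^+ k = - \sum_(j < d) c j * a ^+ (k - d + j) * b ^+ (d - j).
  rewrite -{1}(subnK ledk) exprD; move/eqP: rel; rewrite addr_eq0 => /eqP->.
  rewrite mulrN big_distrr /=; congr (- _); apply: eq_bigr => j _.
  by rewrite exprD; ring.
rewrite mulrN big_distrr /= -sumrN.
apply: (big_ind (fun x => exists e, x = b ^+ k * e)) => [||j _].
- by exists 0; rewrite mulr0.
- by move=> _ _ [e1 ->] [e2 ->]; exists (e1 + e2); rewrite mulrDr.
- have ltj := ltn_ord j.
  have [|e He] := IH (k - d + j)%N; first by lia.
  exists (- (c j * e)).
  have -> : b ^+ k = b ^+ (k - d + j) * b ^+ (d - j) by rewrite -exprD; congr (_ ^+ _); lia.
  rewrite mulrN; congr (- _).
  transitivity (c j * b ^+ (d - j) * (b ^+ d * a ^+ (k - d + j))); first by ring.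
  by rewrite He; ring.
Qed.


(** * Multivariate polynomials: substitution and evaluation *)

Lemma mpoly_ring_ind (R : comNzRingType) (k : nat) (P : {mpoly R[k]} -> Prop) :
  (forall c, P c%:MP) -> (forall i, P 'X_i) ->
  (forall p q, P p -> P q -> P (p + q)) ->
  (forall p q, P p -> P q -> P (p * q)) -> forall p, P p.
Proof.
move=> PC PX PD PM p; rewrite (mpolyE p).
have P0 : P 0 by rewrite -mpolyC0; apply: PC.
have P1 : P 1 by rewrite -mpolyC1; apply: PC.
apply: (big_ind P) => // m _; rewrite -mul_mpolyC; apply: (PM _ _ (PC _)).
rewrite mpolyXE_id; apply: (big_ind P) => // i _.
by elim: (m i) => [|e IH]; rewrite ?expr0 // exprS; apply: PM.
Qed.

Lemma mpoly_morph_eq (R S : comNzRingType) (k : nat)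
    (f g : {rmorphism {mpoly R[k]} -> S}) :
  (forall c, f c%:MP = g c%:MP) -> (forall i, f 'X_i = g 'X_i) -> f =1 g.
Proof.
move=> hC hX; apply: mpoly_ring_ind => // p q hp hq; first by rewrite !rmorphD hp hq.
by rewrite !rmorphM hp hq.
Qed.

Notation "p \Ps h" := (comp_mpoly [tuple h i | i < _] p)
  (at level 40, left associativity).

Lemma mcoeff_sum (R : nzRingType) k (I : Type) (s : seq I) (P : pred I)
    (F : I -> {mpoly R[k]}) m :
  (\sum_(i <- s | P i) F i)@_m = \sum_(i <- s | P i) (F i)@_m.
Proof. by rewrite raddf_sum. Qed.

Section Substitution.
Variables (R : comNzRingType) (k l : nat).
Implicit Types (h : 'I_k -> {mpoly R[l]}) (p : {mpoly R[k]}).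

Lemma psubstX h i : 'X_i \Ps h = h i.
Proof. by rewrite comp_mpolyXU -tnth_nth tnth_mktuple. Qed.

Lemma psubst_eval h p v : (p \Ps h).@[v] = p.@[fun i => (h i).@[v]].
Proof. by rewrite comp_mpoly_meval; apply: meval_eq => i; rewrite tnth_mktuple. Qed.

Lemma psubst_monom h m : 'X_[m] \Ps h = \prod_(i < k) h i ^+ m i.
Proof. by rewrite comp_mpolyX; apply: eq_bigr => i _; rewrite tnth_mktuple. Qed.

Lemma psubst_comp j h (g : 'I_l -> {mpoly R[j]}) p :
  (p \Ps h) \Ps g = p \Ps (fun i => h i \Ps g).
Proof.
apply: (@mpoly_morph_eq _ _ _ (comp_mpoly [tuple g i | i < l] \o comp_mpoly [tuple h i | i < k])
  (comp_mpoly [tuple h i \Ps g | i < k])) => [c|i] /=.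
  by rewrite !comp_mpolyC.
by rewrite psubstX comp_mpolyXU -tnth_nth tnth_mktuple.
Qed.

Lemma psubst_sum (I : Type) (s : seq I) (P : pred I) (F : I -> {mpoly R[k]}) h :
  (\sum_(i <- s | P i) F i) \Ps h = \sum_(i <- s | P i) (F i \Ps h).
Proof. by rewrite raddf_sum. Qed.
End Substitution.

Local Notation widen := (widen_ord (leqnSn _)).

Section Univariate.
Variables (R : comNzRingType) (k : nat).

Lemma muni_widen i : muni ('X_(widen i) : {mpoly R[k.+1]}) = ('X_i)%:P.
Proof.
rewrite muniE msuppX big_seq1 mcoeffX eqxx scale1r mnm1E.
have -> : (widen i == ord_max) = false by rewrite -val_eqE /= ltn_eqF.
rewrite expr0 alg_polyC; congr (_ %:P); congr ('X_[_]).
by apply/mnmP => j; rewrite mnmE !mnm1E -!val_eqE.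
Qed.

Lemma muni_max : muni ('X_ord_max : {mpoly R[k.+1]}) = 'X.
Proof.
rewrite muniE msuppX big_seq1 mcoeffX eqxx scale1r mnm1E eqxx expr1.
rewrite -[X in X *: _](_ : 1 = _) ?scale1r // -mpolyX0; congr ('X_[_]).
by apply/mnmP => j; rewrite mnmE mnm0E mnm1E -val_eqE /= gtn_eqF.
Qed.

Lemma muniXn (p : {mpoly R[k.+1]}) e : muni (p ^+ e) = muni p ^+ e.
Proof. by elim: e => [|e IH]; rewrite ?muni1 // !exprS muniM IH. Qed.

Variable S : comNzRingType.

(** Lets evaluations and substitutions be computed in the last variable alone, for inductions on the
    number of variables. *)
Lemma muni_morph_eq (f : {rmorphism {mpoly R[k.+1]} -> S})
    (g : {rmorphism {mpoly R[k]} -> S}) (x : S) :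
  (forall c, f c%:MP = g c%:MP) -> (forall i, f 'X_(widen i) = g 'X_i) ->
  f 'X_ord_max = x -> forall p, f p = (map_poly g (muni p)).[x].
Proof.
move=> hC hw hm p; have cgx : commr_rmorph g x by move=> ?; apply: mulrC.
apply: (@mpoly_morph_eq _ _ _ f (horner_morph cgx \o @muni k R)) => [c|i] /=.
  by rewrite muniC horner_morphC.
have [lti|] := ltnP i k; last first.
  move=> ki; have -> : i = ord_max by apply/val_inj/eqP; rewrite eqn_leq ki -ltnS ltn_ord.
  by rewrite muni_max horner_morphX.
have -> : i = widen (Ordinal lti) by apply: val_inj.
by rewrite muni_widen horner_morphC.
Qed.
End Univariate.

Lemma muniK (R : comNzRingType) k (p : {mpoly R[k.+1]}) :
  (map_poly (@mwiden k R) (muni p)).['X_ord_max] = p.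
Proof.
symmetry; apply: (@muni_morph_eq _ _ _ idfun (@mwiden k R)) => //= [c'|i].
  by rewrite mwidenC.
by rewrite mwidenX mnmwiden1.
Qed.

Lemma mpoly_cic (K : fieldType) k : completely_integrally_closed {mpoly K[k]}.
Proof.
elim: k => [|k IH] a b c nzc H.
  have [b0|nzb] := eqVneq b 0.
    have [e /eqP] := H 1%N; rewrite !expr1 b0 mul0r mulf_eq0 (negbTE nzc) /= => /eqP->.
    by exists 0; rewrite mulr0.
  exists ((b@_0%MM)^-1 *: a).
  rewrite -scalerAr scalerAl [X in _ *: X]nvar0_mpolyC -mul_mpolyC -mpolyCM mulVf ?mul1r //.
  by apply: contraNneq nzb => b0; rewrite (nvar0_mpolyC b) b0.
pose back q := (map_poly (@mwiden k K) q).['X_ord_max].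
have backK p : back (muni p) = p by apply: muniK.
have nzmc : muni c != 0.
  by apply: contraNneq nzc => c0; rewrite -(backK c) c0 /back rmorph0 horner0.
have [n|e He] := poly_cic IH (a := muni a) (b := muni b) nzmc.
  have [e He] := H n; exists (muni e); move/(congr1 (@muni _ _)): He.
  by rewrite !muniM !muniXn.
exists (back e); rewrite -[a]backK He -[in RHS](backK b) /back rmorphM hornerM //.
Qed.

Definition infinite_field (K : fieldType) :=
  forall p : {poly K}, p != 0 -> exists x, p.[x] != 0.

Lemma closed_infinite (K : closedFieldType) : infinite_field K.
Proof. by move=> p nzp; apply/closed_nonrootP. Qed.

(** Choose by induction a point where the leading coefficient in the last variable survives, then a
    value of that variable. *)
Lemma mpoly_nonroot (K : fieldType) (infK : infinite_field K) k (p : {mpoly K[k]}) :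
  p != 0 -> exists v, p.@[v] != 0.
Proof.
elim: k p => [|k IH] p nzp.
  exists (fun _ => 0); rewrite (nvar0_mpolyC p) mevalC.
  by apply: contraNneq nzp => p0; rewrite (nvar0_mpolyC p) p0.
have nzm : muni p != 0.
  apply: contraNneq nzp => p0.
  by rewrite -(muniK p) p0 rmorph0 horner0.
have nzl : lead_coef (muni p) != 0 by rewrite lead_coef_eq0.
have [v Hv] := IH _ nzl.
have [|x Hx] := infK (map_poly (meval v) (muni p)).
  apply: contraNneq Hv => /(congr1 (fun q : {poly _} => q`_(size (muni p)).-1)).
  by rewrite coef_map coef0 lead_coefE => ->.
pose w (i : 'I_k.+1) := if insub (val i) is Some j then v j else x.
exists w; apply: contraNneq Hx => <-; apply/eqP; symmetry.
apply: (@muni_morph_eq _ _ _ (meval w) (meval v)) => [c|i|] /=.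
- by rewrite !mevalC.
- by rewrite !mevalXU /w; case: insubP => /= [j _ /val_inj ->|] //; rewrite ltn_ord.
- by rewrite mevalXU /w; case: insubP => //= j; rewrite ltnn.
Qed.

Lemma mpoly_eq0_eval (K : fieldType) (infK : infinite_field K) k (p : {mpoly K[k]}) :
  (forall v, p.@[v] = 0) -> p = 0.
Proof.
move=> p0; apply/eqP; case: (eqVneq p 0) => // /(mpoly_nonroot infK) [v].
by rewrite p0 eqxx.
Qed.

(** * Algebraic dependence *)

Section AlgebraicDependence.
Variables (K : fieldType) (d : nat).

Definition deg_bounded (B : nat) (p : {mpoly K[d]}) :=
  forall m, p@_m != 0 -> (mdeg m <= B)%N.

Lemma deg_boundedM B1 B2 p q :
  deg_bounded B1 p -> deg_bounded B2 q -> deg_bounded (B1 + B2) (p * q).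
Proof.
move=> bp bq m; rewrite -mcoeff_msupp => /msuppM_le /allpairsP [[m1 m2] /= [h1 h2 ->]].
by rewrite mdegD leq_add ?bp ?bq // -mcoeff_msupp.
Qed.

Lemma deg_boundedX B p e : deg_bounded B p -> deg_bounded (e * B) (p ^+ e).
Proof.
move=> bp; elim: e => [|e IH]; last by rewrite exprS mulSn; apply: deg_boundedM.
move=> m; rewrite expr0 mcoeff1; case: (m =P 0%MM) => [->|_]; last by rewrite eqxx.
by rewrite mdeg0.
Qed.

(** A count of monomials: the e^k products of powers of the [h l] with exponents below e lie in a
    space of dimension at most b^d, which is smaller for large e. *)
Lemma mpoly_alg_dep k (h : 'I_k -> {mpoly K[d]}) : (d < k)%N ->
  exists F : {mpoly K[k]}, F != 0 /\ F \Ps h = 0.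
Proof.
move=> ltdk.
pose C := \max_j msize (h j).
(* Since b is at most (kC + 1)e, b^d is at most (kC + 1)^d e^d. This choice of e makes that less
   than e^(d+1), hence less than e^k. *)
pose e := (((k * C).+1) ^ d).+1.
pose b := (k * (e * C)).+1.
pose A := {ffun 'I_k -> 'I_e}; pose B := {ffun 'I_d -> 'I_b}.
have cardAB : (#|B| < #|A|)%N.
  rewrite !card_ffun !card_ord.
  apply: (@leq_ltn_trans (((k * C).+1 * e) ^ d)).
    have [->|d_gt0] := posnP d; first by rewrite !expn0.
    by rewrite leq_exp2r // /b /e; nia.
  rewrite expnMn; apply: (@leq_trans (e ^ d.+1)); last by rewrite leq_pexp2l.
  by rewrite expnS ltn_mul2r expn_gt0 ltnSn.
pose mon (a : A) : 'X_{1..k} := [multinom (a l : nat) | l < k].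
pose H (a : A) := \prod_(l < k) h l ^+ a l.
have bH a : deg_bounded (k * (e * C)) (H a).
  have : deg_bounded (\sum_(l < k) a l * C) (H a).
    rewrite /H; elim/big_rec2: _ => [|l B0 p _ IH].
      by move=> m; rewrite mcoeff1; case: (m =P 0%MM) => [->|_]; rewrite ?mdeg0 ?eqxx.
    apply: deg_boundedM => //; apply: deg_boundedX => m.
    rewrite -mcoeff_msupp => /msize_mdeg_lt /ltnW /leq_trans; apply.
    exact: (leq_bigmax l).
  move=> bd m /bd /leq_trans; apply.
  have -> : (k * (e * C) = \sum_(l < k) e * C)%N by rewrite sum_nat_const card_ord.
  by apply: leq_sum => l _; rewrite leq_mul2r ltnW ?orbT.
pose M : 'M[K]_(#|A|, #|B|) :=
  \matrix_(i, j) (H (enum_val i))@_[multinom ((enum_val j : B) l : nat) | l < d].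
have /rowV0Pn [v /sub_kermxP vM nzv] : kermx M != 0.
  rewrite kermx_eq0 /row_free neq_ltn (leq_ltn_trans (rank_leq_col M)) //.
pose F : {mpoly K[k]} := \sum_i v 0 i *: 'X_[mon (enum_val i)].
have inj_mon : injective mon.
  move=> a1 a2 /mnmP eqm; apply/ffunP => l; apply: val_inj.
  by have := eqm l; rewrite !mnmE.
exists F; split.
  have [i nzi] : exists i, v 0 i != 0.
    apply: NNPP => none; case/eqP: nzv; apply/rowP => i; rewrite mxE.
    by apply/eqP/negPn/negP => nzi; apply: none; exists i.
  apply: contraNneq nzi => F0; have := congr1 (mcoeff (mon (enum_val i))) F0.
  rewrite mcoeff0 raddf_sum /= (bigD1 i) //= mcoeffZ mcoeffX eqxx mulr1 big1 ?addr0 => [->//|j nji].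
  rewrite mcoeffZ mcoeffX (inj_eq inj_mon) (inj_eq enum_val_inj) (negbTE nji) mulr0 //.
have -> : F \Ps h = \sum_i v 0 i *: H (enum_val i).
  rewrite /F raddf_sum /=; apply: eq_bigr => i _.
  rewrite linearZ /= psubst_monom; congr (_ *: _).
  by apply: eq_bigr => l _; rewrite mnmE.
apply/mpolyP => m; rewrite mcoeff0 raddf_sum /=.
have [small|big] := leqP (mdeg m) (k * (e * C)).
  have ltm l : (m l < b)%N.
    by rewrite ltnS (leq_trans _ small) // mdegE (bigD1 l) //= leq_addr.
  pose be : B := [ffun l => Ordinal (ltm l)].
  have := congr1 (fun w : 'rV_#|B| => w 0 (enum_rank be)) vM; rewrite !mxE => sum0.
  rewrite -[RHS]sum0; apply: eq_bigr => i _; rewrite mcoeffZ !mxE; congr (_ * _@__).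
  by apply/mnmP => l; rewrite mnmE enum_rankK ffunE.
apply: big1 => i _; rewrite mcoeffZ; apply/eqP; rewrite mulf_eq0; apply/orP; right.
by apply: contraTT big => /bH; rewrite -leqNgt.
Qed.
End AlgebraicDependence.

(** * Ideals and the charts of the zero fibre *)

Section Ideals.
Variables (K : fieldType) (N m : nat) (f : 'I_m -> {mpoly K[N]}).
Implicit Types p q : {mpoly K[N]}.

Lemma in_ideal0 : in_ideal f 0.
Proof. by exists (fun _ => 0); rewrite big1 // => i _; rewrite mul0r. Qed.

Lemma in_idealD p q : in_ideal f p -> in_ideal f q -> in_ideal f (p + q).
Proof.
move=> [c ->] [d ->]; exists (fun i => c i + d i).
by rewrite -big_split; apply: eq_bigr => i _; rewrite mulrDl.
Qed.

Lemma in_idealMl p q : in_ideal f q -> in_ideal f (p * q).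
Proof.
move=> [c ->]; exists (fun i => p * c i).
by rewrite big_distrr; apply: eq_bigr => i _; rewrite /= mulrA.
Qed.

Lemma in_idealMr p q : in_ideal f p -> in_ideal f (p * q).
Proof. by rewrite mulrC; apply: in_idealMl. Qed.

Lemma in_idealZ a p : in_ideal f p -> in_ideal f (a *: p).
Proof. by rewrite -mul_mpolyC; apply: in_idealMl. Qed.

Lemma in_idealN p : in_ideal f p -> in_ideal f (- p).
Proof. by rewrite -mulN1r; apply: in_idealMl. Qed.

Lemma in_idealB p q : in_ideal f p -> in_ideal f q -> in_ideal f (p - q).
Proof. by move=> ip /in_idealN; apply: in_idealD. Qed.

Lemma in_ideal_gen i : in_ideal f (f i).
Proof.
exists (fun j => (j == i)%:R); rewrite (bigD1 i) //= eqxx mul1r big1 ?addr0 //.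
by move=> j /negbTE ->; rewrite mul0r.
Qed.

Lemma in_ideal_sum (I : Type) (s : seq I) (P : pred I) (F : I -> {mpoly K[N]}) :
  (forall i, P i -> in_ideal f (F i)) -> in_ideal f (\sum_(i <- s | P i) F i).
Proof. by move=> h; apply: big_ind => //; [apply: in_ideal0 | apply: in_idealD]. Qed.

Lemma in_ideal_eval p v : in_ideal f p -> zeroset f v -> p.@[v] = 0.
Proof.
by move=> [c ->] zv; rewrite raddf_sum big1 //= => i _; rewrite mevalM zv mulr0.
Qed.

Lemma in_ideal_psubst l (h : 'I_N -> {mpoly K[l]}) p :
  (forall i, f i \Ps h = 0) -> in_ideal f p -> p \Ps h = 0.
Proof. by move=> fh [c ->]; rewrite rmorph_sum big1 //= => i _; rewrite rmorphM /= fh mulr0. Qed.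

Lemma in_ideal_psubst_sub l (g h : 'I_l -> {mpoly K[N]}) (p : {mpoly K[l]}) :
  (forall i, in_ideal f (g i - h i)) -> in_ideal f (p \Ps g - p \Ps h).
Proof.
move=> gh; elim/mpoly_ring_ind: p => [c|i|p q ip iq|p q ip iq].
- by rewrite !comp_mpolyC subrr; apply: in_ideal0.
- by rewrite !psubstX.
- by rewrite !rmorphD /= opprD addrACA; apply: in_idealD.
rewrite !rmorphM /=.
have -> : forall a b c d : {mpoly K[N]}, a * b - c * d = (a - c) * b + c * (b - d).
  by move=> *; ring.
by apply: in_idealD; [apply: in_idealMr | apply: in_idealMl].
Qed.
End Ideals.

Lemma in_ideal_trans (K : fieldType) (N m m' : nat) (f : 'I_m -> {mpoly K[N]})
    (g : 'I_m' -> {mpoly K[N]}) p :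
  (forall i, in_ideal g (f i)) -> in_ideal f p -> in_ideal g p.
Proof. by move=> h [c ->]; apply: in_ideal_sum => i _; apply: in_idealMl. Qed.

Section Charts.
Variables (K : fieldType) (n r : nat) (S : 'M[K]_(n, r)).
Hypothesis infK : infinite_field K.

Definition moment_gen (j : 'I_r) : {mpoly K[n + n]} :=
  \sum_(i < n) S i j *: ('X_(lshift n i) * 'X_(rshift n i)).

Definition xy (i : 'I_n) : {mpoly K[n + n]} := 'X_(lshift n i) * 'X_(rshift n i).

(** With C a pseudo-inverse of S, the matrix Q = 1 - SC maps every row vector into the left kernel.
    Modulo the ideal the vector xy equals xy Q, and q vanishes identically at xy Q. *)
Lemma kernel_vanishing_in_ideal (q : {mpoly K[n]}) :
  (forall u : 'rV_n, u *m S = 0 -> q.@[u 0] = 0) -> in_ideal moment_gen (q \Ps xy).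
Proof.
move=> q0; pose C := pinvmx S; pose Q := 1%:M - S *m C.
have QS : Q *m S = 0.
  by rewrite mulmxBl mul1mx mulmxKpV ?subrr.
pose w i := \sum_k Q k i *: xy k.
have -> : q \Ps xy = (q \Ps xy - q \Ps w) + q \Ps w by rewrite subrK.
apply: in_idealD.
  apply: in_ideal_psubst_sub => i.
  have -> : xy i - w i = \sum_j C j i *: moment_gen j.
    transitivity (\sum_k (S *m C) k i *: xy k).
      have {1}-> : xy i = \sum_k (1%:M : 'M[K]_n) k i *: xy k.
        rewrite (bigD1 i) //= mxE eqxx scale1r big1 ?addr0 // => k /negbTE nki.
        by rewrite mxE nki scale0r.
      rewrite -sumrB; apply: eq_bigr => k _.
      by rewrite -scalerBl; congr (_ *: _); rewrite !mxE opprB addrC subrK.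
    transitivity (\sum_k \sum_j (S k j * C j i) *: xy k).
      by apply: eq_bigr => k _; rewrite mxE scaler_suml.
    rewrite exchange_big; apply: eq_bigr => j _.
    by rewrite scaler_sumr; apply: eq_bigr => k _; rewrite scalerA mulrC.
  by apply: in_ideal_sum => j _; apply/in_idealZ/in_ideal_gen.
suff -> : q \Ps w = 0 by apply: in_ideal0.
apply: (mpoly_eq0_eval infK) => v.
rewrite psubst_eval.
pose a : 'rV[K]_n := \row_k (xy k).@[v].
rewrite -(q0 (a *m Q)) ?mulmxA -?mulmxA ?QS ?mulmx0 //.
apply: meval_eq => i; rewrite mxE raddf_sum; apply: eq_bigr => k _.
by rewrite [a _ _]mxE mulrC /= mevalZ.
Qed.

Local Notation m := (\rank (kermx S)).
Definition ker_base : 'M[K]_(m, n) := row_base (kermx S).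

Lemma ker_base_mul : ker_base *m S = 0.
Proof. by apply/sub_kermxP; rewrite eq_row_base. Qed.

Lemma ker_baseP (u : 'rV_n) : u *m S = 0 -> exists t, u = t *m ker_base.
Proof. by move/sub_kermxP; rewrite -(eq_row_base (kermx S)) => /submxP. Qed.

Definition zvar (i : 'I_n) : {mpoly K[n + m]} := 'X_(lshift m i).
Definition tvar (j : 'I_m) : {mpoly K[n + m]} := 'X_(rshift n j).
Definition lam i := \sum_j ker_base j i *: tvar j.
Definition zprod := \prod_j zvar j.
Definition chart (I : {set 'I_n}) (v : 'I_(n + n)) : {mpoly K[n + m]} :=
  match split v with
  | inl i => if i \in I then zvar i else lam i * \prod_(j | j != i) zvar j
  | inr i => if i \in I then lam i * \prod_(j | j != i) zvar j else zvar i
  end.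

Lemma chartl I i : chart I (lshift n i) =
  if i \in I then zvar i else lam i * \prod_(j | j != i) zvar j.
Proof. by rewrite /chart (unsplitK (inl i)). Qed.

Lemma chartr I i : chart I (rshift n i) =
  if i \in I then lam i * \prod_(j | j != i) zvar j else zvar i.
Proof. by rewrite /chart (unsplitK (inr i)). Qed.

Lemma zprodE i : zprod = zvar i * \prod_(j | j != i) zvar j.
Proof. by rewrite /zprod (bigD1 i). Qed.

(** All charts agree on the torus invariants x_i y_i, whose vector becomes a multiple of a point of
    the left kernel. *)
Lemma chart_xy I i : xy i \Ps (chart I) = lam i * zprod.
Proof.
rewrite rmorphM /= !psubstX chartl chartr (zprodE i).
by case: ifP => _; ring.
Qed.

Lemma chart_gen I j : moment_gen j \Ps (chart I) = 0.
Proof.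
rewrite raddf_sum /=.
transitivity (\sum_i (S i j *: lam i) * zprod).
  apply: eq_bigr => i _; rewrite linearZ /= -/(xy i) chart_xy.
  by rewrite scalerAl.
rewrite -mulr_suml [X in X * _](_ : _ = 0) ?mul0r //.
transitivity (\sum_k (ker_base *m S) k j *: tvar k).
  transitivity (\sum_i \sum_k (S i j * ker_base k i) *: tvar k).
    by apply: eq_bigr => i _; rewrite scaler_sumr; apply: eq_bigr => k _; rewrite scalerA.
  rewrite exchange_big; apply: eq_bigr => k _; rewrite mxE scaler_suml.
  by apply: eq_bigr => i _; rewrite mulrC.
by rewrite big1 // => k _; rewrite ker_base_mul mxE scale0r.
Qed.

Lemma chart_ideal I p : in_ideal moment_gen p -> p \Ps (chart I) = 0.
Proof. by apply: in_ideal_psubst => j; apply: chart_gen. Qed.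
End Charts.

(** * The torus grading *)

Section Grading.
Variables (K : fieldType) (d : nat) (G : zmodType) (wt : 'X_{1..d} -> G).
Hypothesis wt0 : wt 0%MM = 0.
Hypothesis wtD : forall m1 m2, wt (m1 + m2)%MM = wt m1 + wt m2.
Implicit Types p q : {mpoly K[d]}.

Definition whomog (w : G) p := forall m, p@_m != 0 -> wt m = w.

Lemma whomogM w1 w2 p q : whomog w1 p -> whomog w2 q -> whomog (w1 + w2) (p * q).
Proof.
move=> hp hq m; rewrite -mcoeff_msupp => /msuppM_le /allpairsP [[m1 m2] /= [h1 h2 ->]].
by rewrite wtD (hp m1) ?(hq m2) // -mcoeff_msupp.
Qed.

Lemma whomog1 : whomog 0 1.
Proof. by move=> m; rewrite mcoeff1; case: (m =P 0%MM) => [->|_]; rewrite ?wt0 ?eqxx. Qed.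

Lemma whomog_prod (I : Type) (s : seq I) (P : pred I) (w : I -> G) F :
  (forall i, whomog (w i) (F i)) ->
  whomog (\sum_(i <- s | P i) w i) (\prod_(i <- s | P i) F i).
Proof.
move=> h; elim/big_rec2: _ => [|i p w0 _ IH]; first exact: whomog1.
exact: whomogM.
Qed.

Lemma whomogXn w p e : whomog w p -> whomog (w *+ e) (p ^+ e).
Proof.
move=> h; rewrite -[e]card_ord -sumr_const -prodr_const.
exact: whomog_prod.
Qed.

Lemma whomogX m : whomog (wt m) 'X_[m].
Proof. by move=> m'; rewrite mcoeffX; case: (m =P m') => [->|] //; rewrite eqxx. Qed.

Lemma whomog_sum (I : Type) (s : seq I) (P : pred I) w (F : I -> {mpoly K[d]}) :
  (forall i, P i -> whomog w (F i)) -> whomog w (\sum_(i <- s | P i) F i).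
Proof.
move=> h; apply: (big_ind (whomog w)) => // [m|p q hp hq m].
  by rewrite mcoeff0 eqxx.
rewrite mcoeffD; have [p0|/hp //] := eqVneq p@_m 0; by rewrite p0 add0r; apply: hq.
Qed.

Lemma whomogZ w a p : whomog w p -> whomog w (a *: p).
Proof. by move=> h m; rewrite mcoeffZ mulf_eq0 negb_or => /andP[_ /h]. Qed.
End Grading.

(** * Homogeneous components of a polynomial and the kernels of the charts *)

Section Core.
Variables (K : fieldType) (n r : nat) (S : 'M[K]_(n, r)).
Hypothesis infK : infinite_field K.
Local Notation m := (\rank (kermx S)).
Implicit Types (I : {set 'I_n}) (p : {mpoly K[n + n]}) (k : 'X_{1..n + n}).

(* The monomials z^a t^b and t_j z_1 ... z_n should have the torus weights of
   their images under the un-rescaled parametrisation y_i = lam_i(t) / z_i, in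
   which t is invariant; hence t_j has weight (-1, ..., -1) here. *)
Definition zwt (e : 'X_{1..n + m}) : 'rV[int]_n :=
  \row_i ((e (lshift m i))%:Z - (\sum_j e (rshift n j))%:Z).

Lemma zwt0 : zwt 0%MM = 0.
Proof. by apply/rowP => i; rewrite !mxE mnm0E big1 // => j _; rewrite mnm0E. Qed.

Lemma zwtD e1 e2 : zwt (e1 + e2)%MM = zwt e1 + zwt e2.
Proof.
apply/rowP => i; rewrite !mxE mnmDE.
have -> : (\sum_j (e1 + e2)%MM (rshift n j) =
   \sum_(j < m) e1 (rshift n j) + \sum_(j < m) e2 (rshift n j))%N.
  by rewrite -big_split; apply: eq_bigr => j _; rewrite mnmDE.
by rewrite !PoszD; ring.
Qed.

Local Notation zhomog := (whomog zwt).
Definition unit_row (i : 'I_n) : 'rV[int]_n := delta_mx 0 i.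

Lemma zvar_homog i : zhomog (unit_row i) (zvar S i).
Proof.
have -> : unit_row i = zwt U_(lshift m i).
  apply/rowP => j; rewrite !mxE mnm1E eqxx /= (inj_eq (@lshift_inj _ _)) eq_sym.
  rewrite big1 ?subr0 // => [|k _]; first by case: eqP.
  by rewrite mnm1E eq_lrshift.
exact: whomogX.
Qed.

Lemma lam_homog i : zhomog (const_mx (-1)) (lam S i).
Proof.
apply: whomog_sum => j _; apply: whomogZ.
have -> : const_mx (-1) = zwt U_(rshift n j).
  apply/rowP => k; rewrite !mxE mnm1E eq_rlshift sub0r (bigD1 j) //= mnm1E eqxx.
  rewrite big1 // => l /negbTE nlj; rewrite mnm1E (inj_eq (@rshift_inj _ _)) eq_sym nlj //.
exact: whomogX.
Qed.

Definition chart_wt I (v : 'I_(n + n)) : 'rV[int]_n :=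
  match split v with
  | inl i => if i \in I then unit_row i else - unit_row i
  | inr i => if i \in I then - unit_row i else unit_row i
  end.

Lemma chart_homog I v : zhomog (chart_wt I v) (chart S I v).
Proof.
have lam_other i : zhomog (- unit_row i) (lam S i * \prod_(j | j != i) zvar S j).
  (* The weight (-1, ..., -1) of [lam] is compensated by the product over j != i in every coordinate
     except the i-th. *)
  have -> : - unit_row i = const_mx (-1) + \sum_(j | j != i) unit_row j.
    have -> : const_mx (-1) = - \sum_j unit_row j :> 'rV[int]_n.
      apply/rowP => l; rewrite !mxE summxE (bigD1 l) //= mxE !eqxx big1 ?addr0 // => j.
      by rewrite mxE eqxx eq_sym => /negbTE ->.
    by rewrite [in RHS](bigD1 i) //= opprD subrK.
  apply: (whomogM zwtD); first exact: lam_homog.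
  by apply: (whomog_prod zwt0 zwtD) => j; apply: zvar_homog.
by rewrite /chart_wt /chart; case: split => i; case: ifP => _ //; apply: zvar_homog.
Qed.

(* Truncated subtraction: for each i at most one of x_i, y_i divides X^(reduced_part e). *)
Definition reduced_part (e : 'X_{1..n + n}) : 'X_{1..n + n} :=
  [multinom match split v with
            | inl i => e (lshift n i) - e (rshift n i)
            | inr i => e (rshift n i) - e (lshift n i) end%N | v < n + n].
Definition common_part (e : 'X_{1..n + n}) : 'X_{1..n} :=
  [multinom minn (e (lshift n i)) (e (rshift n i)) | i < n].

Lemma reduced_partl e i :
  reduced_part e (lshift n i) = (e (lshift n i) - e (rshift n i))%N.
Proof. by rewrite mnmE (unsplitK (inl i)). Qed.

Lemma reduced_partr e i :
  reduced_part e (rshift n i) = (e (rshift n i) - e (lshift n i))%N.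
Proof. by rewrite mnmE (unsplitK (inr i)). Qed.

Lemma monom_parts e : 'X_[e] =
  'X_[reduced_part e] * ('X_[common_part e] \Ps @xy K n).
Proof.
rewrite psubst_monom !mpolyXE_id !big_split_ord /=.
rewrite -!big_split; apply: eq_bigr => i _ /=.
rewrite reduced_partl reduced_partr mnmE exprMn mulrACA -!exprD.
by congr (_ ^+ _ * _ ^+ _); lia.
Qed.

Lemma monom_chart_homog I (e : 'X_{1..n + n}) :
  zhomog (\sum_v chart_wt I v *+ e v) ('X_[e] \Ps chart S I).
Proof.
rewrite psubst_monom; apply: (whomog_prod zwt0 zwtD) => v.
exact/(whomogXn zwt0 zwtD)/chart_homog.
Qed.

(** The i-th coordinate of the weight is, up to a sign fixed by I, the exponent of x_i minus that of
    y_i; the reduced part depends only on these differences. *)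
Lemma reduced_part_eq I (e1 e2 : 'X_{1..n + n}) :
  \sum_v chart_wt I v *+ e1 v = \sum_v chart_wt I v *+ e2 v ->
  reduced_part e1 = reduced_part e2.
Proof.
have wtE (e : 'X_{1..n + n}) i : (\sum_v chart_wt I v *+ e v) 0 i =
    (if i \in I then 1 else -1) * ((e (lshift n i))%:Z - (e (rshift n i))%:Z).
  rewrite summxE big_split_ord /= (bigD1 i) //= [X in _ + X](bigD1 i) //=.
  rewrite !big1 ?addr0 => [|j nji|j nji];
    rewrite /chart_wt ?(unsplitK (inl _)) ?(unsplitK (inr _)) !mulmxnE.
  - by case: ifP => _; rewrite !mxE !eqxx /=; lia.
  - by case: ifP => _; rewrite !mxE [i == j]eq_sym (negbTE nji) ?oppr0 mul0rn.
  - by case: ifP => _; rewrite !mxE [i == j]eq_sym (negbTE nji) ?oppr0 mul0rn.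
move=> eqw; have eqd i : e1 (lshift n i) + e2 (rshift n i) = e2 (lshift n i) + e1 (rshift n i).
  have := congr1 (fun w : 'rV_n => w 0 i) eqw; rewrite !wtE.
  by case: ifP => _; lia.
by apply/mnmP => v; rewrite !mnmE; case: split => i; have := eqd i; lia.
Qed.

(** The factor q in the component X^k q(x_1 y_1, ..., x_n y_n) of p; the keys k index the components
    that occur. *)
Definition core_part p k : {mpoly K[n]} :=
  \sum_(e <- msupp p | reduced_part e == k) p@_e *: 'X_[common_part e].
Definition core_keys p := undup (map reduced_part (msupp p)).

Lemma core_component p k : 'X_[k] * (core_part p k \Ps @xy K n) =
  \sum_(e <- msupp p | reduced_part e == k) p@_e *: 'X_[e].
Proof.
rewrite raddf_sum mulr_sumr; apply: eq_bigr => e /eqP <-.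
by rewrite /= linearZ /= -scalerAr -monom_parts.
Qed.

Lemma core_decomposition p :
  p = \sum_(k <- core_keys p) 'X_[k] * (core_part p k \Ps @xy K n).
Proof.
under eq_bigr do rewrite core_component big_mkcond.
rewrite exchange_big {1}(mpolyE p) big_seq [RHS]big_seq; apply: eq_bigr => e he /=.
have kin : reduced_part e \in core_keys p by rewrite mem_undup map_f.
rewrite (bigD1_seq _ kin) ?undup_uniq //= eqxx big1 ?addr0 // => k /negbTE.
by rewrite eq_sym => ->.
Qed.

Lemma core_part_notin p k : k \notin core_keys p -> core_part p k = 0.
Proof.
rewrite mem_undup => nk; rewrite /core_part big_seq_cond big1 // => e /andP[he /eqP ke].
by rewrite -ke map_f in nk.
Qed.

(** Components with different keys have images of different weights, so they cannot cancel each
    other. *)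
Lemma core_component_chart I p k : p \Ps chart S I = 0 ->
  ('X_[k] * (core_part p k \Ps @xy K n)) \Ps chart S I = 0.
Proof.
have [kp|/core_part_notin ->] := boolP (k \in core_keys p); last first.
  by rewrite raddf0 mulr0 raddf0.
pose H l := ('X_[l] * (core_part p l \Ps @xy K n)) \Ps chart S I.
rewrite -/(H k) => p0.
have supH l a : (H l)@_a != 0 ->
    exists2 e, reduced_part e = l & zwt a = \sum_v chart_wt I v *+ e v.
  rewrite /H core_component psubst_sum mcoeff_sum => /eqP nz.
  apply: NNPP => none; apply: nz; apply: big1 => e /eqP ke.
  rewrite linearZ /= mcoeffZ.
  have [->|nz] := eqVneq (('X_[e] \Ps chart S I)@_a) 0; first by rewrite mulr0.
  by case: none; exists e => //; apply: (monom_chart_homog nz).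
apply/mpolyP => a; rewrite mcoeff0; apply/eqP/negPn/negP => nz.
have [e ke we] := supH _ _ nz.
have := congr1 (mcoeff a) p0; rewrite {1}(core_decomposition p) psubst_sum mcoeff_sum mcoeff0 /=.
rewrite (bigD1_seq k) ?undup_uniq //= -/(H k) big1 ?addr0; first by move/eqP: nz.
move=> l nlk; rewrite -/(H l); apply/eqP/negPn/negP => nz'.
have [e' ke' we'] := supH _ _ nz'.
by case/eqP: nlk; rewrite -ke -ke'; apply: (@reduced_part_eq I); rewrite -we -we'.
Qed.

Lemma chart_kernel I p k : p \Ps chart S I = 0 ->
  'X_[k] \Ps chart S I = 0 \/ in_ideal (moment_gen S) (core_part p k \Ps @xy K n).
Proof.
move=> p0; have/eqP := core_component_chart k p0; rewrite rmorphM /= mulf_eq0.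
case/orP => [/eqP|/eqP q0]; [by left | right].
apply: (kernel_vanishing_in_ideal infK) => u /ker_baseP [t ->].
(* At the point with all z_i = 1 the product [zprod] is 1, so the images of the x_i y_i take the
   values of the given kernel vector. *)
pose w (v : 'I_(n + m)) := match split v with inl _ => 1 | inr j => t 0 j end.
have := congr1 (meval w) q0; rewrite meval0 psubst_comp psubst_eval => q1.
rewrite -[RHS]q1; apply: meval_eq => i; rewrite chart_xy mevalM.
rewrite [X in _ * X](_ : _ = 1); last first.
  rewrite rmorph_prod /= big1 // => j _.
  by rewrite mevalXU /w (unsplitK (inl j)).
rewrite mulr1 raddf_sum mxE; apply: eq_bigr => j _ /=.
by rewrite mevalZ mevalXU /w (unsplitK (inr j)) mulrC.
Qed.

(** The chart may vary with the component: each one needs only a chart that kills p and keeps its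
    own monomial alive. *)
Lemma in_ideal_of_charts p :
  (forall k, k \in core_keys p ->
     exists2 I, p \Ps chart S I = 0 & 'X_[k] \Ps chart S I != 0) ->
  in_ideal (moment_gen S) p.
Proof.
move=> h; rewrite (core_decomposition p) big_seq; apply: in_ideal_sum => k /h [I p0 nz].
by apply: in_idealMl; case: (chart_kernel k p0) => // k0; rewrite k0 eqxx in nz.
Qed.
End Core.

(** * Zariski closed sets and chains *)

Section ZariskiTopology.
Variables (K : fieldType) (N : nat).
Implicit Types (p q : {mpoly K[N]}) (Y A C : pset K N).

Definition vanishes p Y := forall v, Y v -> p.@[v] = 0.

Lemma vanishes_sub p Y Y' : psub Y Y' -> vanishes p Y' -> vanishes p Y.
Proof. by move=> s h v /s /h. Qed.

Lemma zclosed_vanishing (P : {mpoly K[N]} -> Prop) :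
  zclosed (fun v => forall p, P p -> p.@[v] = 0).
Proof. by exists P. Qed.

Lemma zclosed_hypersurface p : zclosed (fun v => p.@[v] = 0).
Proof. by exists (eq p) => v; split=> [? _ <-|]; last exact. Qed.

Lemma zclosureP A v : zclosure A v <-> (forall p, vanishes p A -> p.@[v] = 0).
Proof.
split=> [clv p pA|h C [P CP] AC]; first exact: (clv _ (zclosed_hypersurface p)).
by apply/CP => p Pp; apply: h => a /AC /CP; apply.
Qed.

Lemma zclosed_separate C Y : zclosed C -> ~ psub Y C ->
  exists p, vanishes p C /\ ~ vanishes p Y.
Proof.
move=> [P CP] nYC; apply: NNPP => none; apply: nYC => v Yv; apply/CP => p Pp.
apply: NNPP => nz; apply: none; exists p; split=> [w /CP|pY]; first exact.
exact/nz/pY.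
Qed.

Lemma irreducible_mul Y p q : irreducible Y -> vanishes (p * q) Y ->
  vanishes p Y \/ vanishes q Y.
Proof.
move=> [_ irr] pq; apply: (irr (fun v => p.@[v] = 0) (fun v => q.@[v] = 0)).
- exact: zclosed_hypersurface.
- exact: zclosed_hypersurface.
by move=> v /pq /eqP; rewrite mevalM mulf_eq0 => /orP[] /eqP; [left | right].
Qed.

Lemma irreducible_of_mul Y : (exists v, Y v) ->
  (forall p q, vanishes (p * q) Y -> vanishes p Y \/ vanishes q Y) -> irreducible Y.
Proof.
move=> neY mulY; split=> // C1 C2 cl1 cl2 cov.
apply: NNPP => /not_or_and [n1 n2].
have [p [p1 np]] := zclosed_separate cl1 n1.
have [q [q2 nq]] := zclosed_separate cl2 n2.
case: (mulY p q) => // v /cov [/p1|/q2]; rewrite mevalM => ->; first by rewrite mul0r.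
by rewrite mulr0.
Qed.

Lemma irreducible_prod Y (I : finType) (P : pred I) (F : I -> {mpoly K[N]}) :
  irreducible Y -> vanishes (\prod_(i | P i) F i) Y ->
  exists2 i, P i & vanishes (F i) Y.
Proof.
move=> irr; rewrite -big_filter.
have sP i : i \in [seq j <- index_enum I | P j] -> P i by rewrite mem_filter => /andP[].
elim: [seq j <- index_enum I | P j] sP => [_|i s IH sP].
  rewrite big_nil => v1; have [[v Yv] _] := irr.
  by have /eqP := v1 v Yv; rewrite meval1 oner_eq0.
rewrite big_cons => /(irreducible_mul irr) [v0|v0].
  by exists i => //; apply: sP; rewrite mem_head.
by apply: IH => // j js; apply: sP; rewrite inE js orbT.
Qed.

Lemma irreducible_ext Y Y' : (forall v, Y v <-> Y' v) -> irreducible Y -> irreducible Y'.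
Proof.
move=> e irr; have [[v Yv] _] := irr.
apply: irreducible_of_mul => [|p q pq]; first by exists v; apply/e.
have [|pY|qY] := @irreducible_mul Y p q irr; first by move=> w /e /pq.
  by left => w /e /pY.
by right => w /e /qY.
Qed.

(** Over an infinite field this is the Zariski closure of the image of the polynomial map h, given
    by the kernel of the substitution. *)
Definition image_closure d (h : 'I_N -> {mpoly K[d]}) : pset K N :=
  fun v => forall p, p \Ps h = 0 -> p.@[v] = 0.

Hypothesis infK : infinite_field K.
Variables (d : nat) (h : 'I_N -> {mpoly K[d]}).

Lemma vanishes_image p : vanishes p (image_closure h) <-> p \Ps h = 0.
Proof.
split=> [pv|p0 v]; last exact.
apply: (mpoly_eq0_eval infK) => t; rewrite psubst_eval.
by apply: pv => q q0; rewrite -psubst_eval q0 meval0.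
Qed.

Lemma image_closure_closed : zclosed (image_closure h).
Proof. exact: zclosed_vanishing. Qed.

Lemma image_closure_irreducible : irreducible (image_closure h).
Proof.
apply: irreducible_of_mul.
  by exists (fun i => (h i).@[fun _ => 0]) => p p0; rewrite -psubst_eval p0 meval0.
move=> p q /vanishes_image /eqP; rewrite rmorphM mulf_eq0.
by case/orP => /eqP ?; [left | right]; apply/vanishes_image.
Qed.

Lemma zclosure_image A : psub A (image_closure h) ->
  (forall p, vanishes p A -> p \Ps h = 0) ->
  forall v, zclosure A v <-> image_closure h v.
Proof.
move=> sub dense v; split=> [/zclosureP cl p p0|im].
  by apply: cl => a /sub /(_ p p0).
by apply/zclosureP => p /dense; apply: im.
Qed.
End ZariskiTopology.

Section Chains.
Variables (K : fieldType) (N : nat).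

(* Divide a relation by powers of the last function, then restrict it to the
   previous member of the chain. *)
Lemma chain_alg_indep k (Y : nat -> pset K N) (f : 'I_k -> {mpoly K[N]}) :
  (forall i, (i <= k)%N -> irreducible (Y i)) ->
  (forall i, (i < k)%N -> psub (Y i) (Y i.+1)) ->
  (forall i : 'I_k, vanishes (f i) (Y i) /\ ~ vanishes (f i) (Y i.+1)) ->
  forall F : {mpoly K[k]}, vanishes (F \Ps f) (Y k) -> F = 0.
Proof.
elim: k f => [|k IH] f irrY subY fY F van.
  have [[v Yv] _] := irrY 0%N isT.
  have := van v Yv; rewrite (nvar0_mpolyC F) comp_mpolyC mevalC => ->.
  by rewrite mpolyC0.
pose f' i := f (widen_ord (leqnSn k) i).
pose comp := comp_mpoly [tuple f' i | i < k].
have FE : F \Ps f = (map_poly comp (muni F)).[f ord_max].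
  apply: (@muni_morph_eq _ _ _ (comp_mpoly [tuple f i | i < k.+1]) comp) => [c|i|] /=.
  - by rewrite /comp !comp_mpolyC.
  - by rewrite /comp !psubstX.
  - by rewrite psubstX.
suff G0 : forall G, vanishes (map_poly comp G).[f ord_max] (Y k.+1) -> G = 0.
  rewrite -(muniK F) (G0 (muni F)) ?rmorph0 ?horner0 //.
  by rewrite -FE.
have [fk nfk] := fY ord_max.
elim/poly_ind => [//|G c IHG]; rewrite rmorphD rmorphM /= map_polyX map_polyC hornerD.
rewrite hornerMX hornerC /= => vG.
have c0 : c = 0.
  apply: (IH f') => [i ik|i ik|i|v Yv].
  - by apply: irrY; apply: leqW.
  - by apply: subY; apply: leqW.
  - exact: (fY (widen_ord (leqnSn k) i)).
  - have := vG v (subY k (ltnSn k) v Yv).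
    by rewrite mevalD mevalM (fk v) // mulr0 add0r.
move: vG; rewrite c0 /comp raddf0 addr0 => vG.
have [/IHG ->|//] := irreducible_mul (irrY _ (leqnn _)) vG.
by rewrite mul0r addr0.
Qed.

(** Functions separating consecutive members of a longer chain become dependent when pulled back to
    d variables. The relation then vanishes on the top member, against [chain_alg_indep]. *)
Lemma chain_bound d (h : 'I_N -> {mpoly K[d]}) k (Y : nat -> pset K N) :
  (forall i, (i <= k)%N -> zclosed (Y i) /\ irreducible (Y i)) ->
  (forall i, (i < k)%N -> psub (Y i) (Y i.+1) /\ ~ psub (Y i.+1) (Y i)) ->
  psub (Y k) (image_closure h) -> (k <= d)%N.
Proof.
move=> Yi Ys Yh; rewrite leqNgt; apply/negP => ltdk.
have /fin_all_exists [f fY] : forall i : 'I_k, exists f : {mpoly K[N]},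
    vanishes f (Y i) /\ ~ vanishes f (Y i.+1).
  move=> i; have [] := Ys i (ltn_ord i); have [cl _] := Yi i (ltnW (ltn_ord i)).
  by move=> _; apply: zclosed_separate.
have [F [nzF F0]] := mpoly_alg_dep (fun i => f i \Ps h) ltdk.
case/eqP: nzF; apply: (chain_alg_indep (Y := Y) (f := f)) => // [i /Yi []//|i /Ys []//|v /Yh hv].
by apply: hv; rewrite psubst_comp.
Qed.
End Chains.

(** * Components of the zero fibre *)

Section MomentFibre.
Variables (K : fieldType) (n r : nat) (S : 'M[K]_(n, r)).
Hypothesis infK : infinite_field K.
Local Notation m := (\rank (kermx S)).
Local Notation Z := (zeroset (moment_gen S)).
Implicit Types (I : {set 'I_n}) (p : {mpoly K[n + n]}).

Definition stratum I : pset K (n + n) :=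
  fun v => Z v /\ forall i : 'I_n, (v (lshift n i) != 0) = (i \in I).

(* lam S i = 0 means that i is a coloop of the row matroid of S. *)
Definition coloop_compl I := forall i, i \notin I -> lam S i = 0.

Definition chart_closure I := image_closure (chart S I).

Definition xy_row (v : pt K (n + n)) : 'rV[K]_n :=
  \row_i (v (lshift n i) * v (rshift n i)).

Lemma moment_zeroP v : Z v <-> xy_row v *m S = 0.
Proof.
have E j : (moment_gen S j).@[v] = (xy_row v *m S) 0 j.
  rewrite raddf_sum mxE; apply: eq_bigr => i _.
  by rewrite /= mevalZ mevalM !mevalXU mxE mulrC.
split=> [z0|k0 j]; last by rewrite E k0 mxE.
by apply/rowP => j; rewrite -E z0 mxE.
Qed.

Lemma lam_eq0P i : lam S i = 0 <-> forall u : 'rV_n, u *m S = 0 -> u 0 i = 0.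
Proof.
split=> [l0 u /ker_baseP [t ->]|u0].
  have := congr1 (meval (fun v => match split v with inl _ => 0 | inr j => t 0 j end)) l0.
  rewrite meval0 => l0'; rewrite -[RHS]l0' raddf_sum mxE; apply: eq_bigr => j _.
  by rewrite /= mevalZ mevalXU (unsplitK (inr j)) mulrC.
rewrite /lam big1 // => j _.
have := u0 (row j (ker_base S)); rewrite -row_mul ker_base_mul row0 mxE => -> //.
by rewrite scale0r.
Qed.

Lemma zvar_neq0 i : zvar S i != 0.
Proof. by rewrite -msupp_eq0 msuppX. Qed.

Lemma zprod_neq0 (P : pred 'I_n) : \prod_(j | P j) zvar S j != 0.
Proof. by apply/prodf_neq0 => j _; apply: zvar_neq0. Qed.

Lemma chart_closure_sub I : psub (chart_closure I) Z.
Proof. by move=> v cv j; apply/cv/chart_gen. Qed.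

(** The only variables that the chart kills are, for [lam S i = 0], x_i when i is outside I and y_i
    when i is in I. *)
Lemma monom_chart_neq0 I (k : 'X_{1..n + n}) :
  (forall i, lam S i = 0 ->
     (i \notin I -> k (lshift n i) = 0%N) /\ (i \in I -> k (rshift n i) = 0%N)) ->
  'X_[k] \Ps chart S I != 0.
Proof.
move=> hk; rewrite psubst_monom; apply/prodf_neq0 => v _.
rewrite expf_eq0 negb_and -leqNgt leqn0 -(splitK v); case: (split v) => i /=.
  rewrite chartl; case: ifP => [_|/negbT iI]; first by rewrite zvar_neq0 orbT.
  have [/hk [/(_ iI) -> //]|nz] := eqVneq (lam S i) 0.
  by rewrite mulf_neq0 ?zprod_neq0 ?orbT.
rewrite chartr; case: ifP => [iI|_]; last by rewrite zvar_neq0 orbT.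
have [/hk [_ /(_ iI) -> //]|nz] := eqVneq (lam S i) 0.
by rewrite mulf_neq0 ?zprod_neq0 ?orbT.
Qed.

(** For reduced k at most one of x_i, y_i divides X^k; at a coloop i the chart is chosen to keep
    that one. All other indices are included, so that [coloop_compl] holds. *)
Definition chart_for (k : 'X_{1..n + n}) : {set 'I_n} :=
  [set i | (lam S i != 0) || (0 < k (lshift n i))%N].

Lemma charts_cover p :
  (forall k, k \in core_keys p -> p \Ps chart S (chart_for k) = 0) ->
  in_ideal (moment_gen S) p.
Proof.
move=> h; apply: (in_ideal_of_charts infK) => k kp.
exists (chart_for k); first exact: h.
move: kp; rewrite mem_undup => /mapP [e _ ->].
apply: monom_chart_neq0 => i li0; rewrite inE li0 eqxx /= reduced_partl reduced_partr.
by split; lia.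
Qed.

Lemma coloop_compl_cover p : (forall I, coloop_compl I -> p \Ps chart S I = 0) ->
  in_ideal (moment_gen S) p.
Proof.
move=> h; apply: charts_cover => k _; apply: h => i.
by rewrite inE negb_or negbK => /andP[/eqP].
Qed.

Lemma moment_radical : radical_ideal (moment_gen S).
Proof.
move=> p k pk; apply: coloop_compl_cover => I _.
have /eqP := chart_ideal I pk; rewrite rmorphXn expf_eq0 => /andP[_ /eqP //].
Qed.

(** Otherwise each such chart closure has an equation that does not vanish on Y. Their product is
    killed by all these charts, so it lies in the ideal and vanishes on Y, contradicting
    irreducibility. *)
Lemma irreducible_in_chart_closure Y : irreducible Y -> psub Y Z ->
  exists2 I, coloop_compl I & psub Y (chart_closure I).
Proof.
move=> irrY YZ; apply: NNPP => none.
have /fin_all_exists [F HF] : forall I : {set 'I_n}, exists p : {mpoly K[n + n]},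
    coloop_compl I -> p \Ps chart S I = 0 /\ ~ vanishes p Y.
  move=> I; have [cI|] := classic (coloop_compl I); last by exists 0.
  have [|p [pI npY]] := zclosed_separate (image_closure_closed (chart S I)) (Y := Y).
    by move=> YI; apply: none; exists I.
  by exists p => _; split=> //; apply/(vanishes_image infK).
pose P (I : {set 'I_n}) := [forall i, (i \notin I) ==> (lam S i == 0)].
have PP I : reflect (coloop_compl I) (P I).
  apply: (iffP forallP) => [h i nI|h i]; first by have /implyP/(_ nI)/eqP := h i.
  by apply/implyP => /h ->.
have [|I /PP cI vI] := @irreducible_prod _ _ Y _ P F irrY; last by have [] := HF I cI.
move=> v /YZ Zv; apply: (in_ideal_eval _ Zv); apply: coloop_compl_cover => I cI.
have [FI _] := HF I cI.
by rewrite (bigD1 I) ?rmorphM /= ?FI ?mul0r //; apply/PP.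
Qed.

(** Each component of p vanishes on the stratum: its core lies in the ideal, or its monomial
    contains a variable killed by the chart. Such a variable is x_i with i outside I, or y_i with
    x_i nonzero and x_i y_i = 0 on the fibre. *)
Lemma stratum_sub_chart_closure I : coloop_compl I -> psub (stratum I) (chart_closure I).
Proof.
move=> cI v [Zv vI] p p0; rewrite (core_decomposition p) raddf_sum big1 //= => k _.
rewrite mevalM; have [/eqP k0|id] := chart_kernel infK k p0; last first.
  by rewrite (in_ideal_eval id Zv) mulr0.
suff -> : ('X_[k]).@[v] = 0 by rewrite mul0r.
move: k0; rewrite psubst_monom => /prodf_eq0 [w _]; rewrite expf_eq0 => /andP [kw cw].
rewrite mevalX (bigD1 w) //= (_ : v w = 0) ?expr0n ?eqn0Ngt ?kw ?mul0r //.
move: cw; rewrite -(splitK w); case: (split w) => i /=.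
  rewrite chartl; case: ifP => [_|/negbT iI _]; first by rewrite (negbTE (zvar_neq0 i)).
  by apply/eqP; move: iI; rewrite -vI negbK.
rewrite chartr; case: ifP => [iI|_]; last by rewrite (negbTE (zvar_neq0 i)).
rewrite mulf_eq0 (negbTE (zprod_neq0 _)) orbF => /eqP/lam_eq0P li0.
have := li0 (xy_row v); rewrite mxE => /(_ (proj1 (moment_zeroP v) Zv)) /eqP.
by rewrite mulf_eq0 -[_ == 0]negbK vI iI /= => /eqP.
Qed.

Lemma stratum_closure I : coloop_compl I ->
  forall v, zclosure (stratum I) v <-> chart_closure I v.
Proof.
move=> cI; apply: zclosure_image; first exact: stratum_sub_chart_closure.
(* Points of the chart with all z_i nonzero land in the stratum; the factor [zprod] takes care of
   the others. *)
move=> p pv; have /eqP : zprod S * (p \Ps chart S I) = 0.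
  apply: (mpoly_eq0_eval infK) => t; rewrite mevalM psubst_eval.
  have [->|nz] := eqVneq (zprod S).@[t] 0; first by rewrite mul0r.
  rewrite pv ?mulr0 //; split.
    by move=> j; rewrite -psubst_eval chart_gen meval0.
  move=> i; rewrite chartl; case: ifP => iI.
    by move: nz; rewrite (zprodE S i) mevalM mulf_eq0 negb_or => /andP[].
  by rewrite (cI i) ?iI // mul0r meval0 eqxx.
by rewrite mulf_eq0 (negbTE (zprod_neq0 _)) => /eqP.
Qed.

(** A coordinate killed by the larger chart is killed by the smaller one. An index in just one of
    the two sets is a coloop, and x_i or y_i is then killed by the larger chart but not by the
    smaller. *)
Lemma chart_closure_inj I I' : coloop_compl I -> coloop_compl I' ->
  psub (chart_closure I) (chart_closure I') -> I = I'.
Proof.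
move=> cI cI' sub.
have van v : chart S I' v = 0 -> chart S I v = 0.
  move=> v0; rewrite -[LHS]psubstX; apply/(vanishes_image infK).
  by apply: (vanishes_sub sub); apply/(vanishes_image infK); rewrite psubstX.
apply/setP => i; apply/idP/idP => iI; apply: contraT => niI.
  have := van (lshift n i); rewrite !chartl iI (negbTE niI) (cI' i niI) mul0r => /(_ erefl) /eqP.
  by rewrite (negbTE (zvar_neq0 i)).
have := van (rshift n i); rewrite !chartr iI (negbTE niI) (cI i niI) mul0r => /(_ erefl) /eqP.
by rewrite (negbTE (zvar_neq0 i)).
Qed.

Lemma moment_components Y : irr_component Z Y <->
  exists I, coloop_compl I /\ (forall v, Y v <-> zclosure (stratum I) v).
Proof.
split=> [[irrY [YZ maxY]]|[I [cI YE]]].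
  have [I cI YI] := irreducible_in_chart_closure irrY YZ.
  exists I; split=> // v; rewrite (stratum_closure cI).
  split=> [/YI //|]; apply: maxY => //; last exact: chart_closure_sub.
  exact: (image_closure_irreducible infK).
have YI v : Y v <-> chart_closure I v by rewrite YE (stratum_closure cI).
split; [|split].
- apply: (@irreducible_ext _ _ (chart_closure I)); first by move=> v; rewrite YI.
  exact: (image_closure_irreducible infK).
- by move=> v /YI; apply: chart_closure_sub.
move=> Y' irrY' YZ' sYY'.
have [I' cI' YI'] := irreducible_in_chart_closure irrY' YZ'.
move=> v /YI' vI'; apply/YI.
by rewrite (@chart_closure_inj I I') // => w /YI /sYY' /YI'.
Qed.

(** At a coloop i the product x_i y_i vanishes on the fibre, while two unit vectors of the fibre
    show that neither factor does. Without coloops only the full index set is admissible, and its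
    chart closure is everything. *)
Lemma moment_irreducible : irreducible Z <-> forall i, lam S i <> 0.
Proof.
split=> [irrZ i li0|nz].
  have [v|vx|vy] := @irreducible_mul _ _ Z 'X_(lshift n i) 'X_(rshift n i) irrZ.
  - move=> /moment_zeroP /(proj1 (lam_eq0P i) li0).
    by rewrite mxE mevalM !mevalXU.
  - pose e := fun w : 'I_(n + n) => (w == lshift n i)%:R : K.
    have /eqP : ('X_(lshift n i)).@[e] = 0; last by rewrite mevalXU /e eqxx oner_eq0.
    apply: vx; apply/moment_zeroP; rewrite (_ : xy_row e = 0) ?mul0mx //.
    by apply/rowP => j; rewrite !mxE /e eq_rlshift mulr0.
  - pose e := fun w : 'I_(n + n) => (w == rshift n i)%:R : K.
    have /eqP : ('X_(rshift n i)).@[e] = 0; last by rewrite mevalXU /e eqxx oner_eq0.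
    apply: vy; apply/moment_zeroP; rewrite (_ : xy_row e = 0) ?mul0mx //.
    by apply/rowP => j; rewrite !mxE /e eq_lrshift mul0r.
have cT I : coloop_compl I -> I = setT.
  move=> cI; apply/setP => i; rewrite inE; apply: contraT => /cI li0.
  by case: (nz i).
apply: (@irreducible_ext _ _ (chart_closure setT)); last exact: image_closure_irreducible.
move=> v; split; first exact: chart_closure_sub.
move=> Zv p p0; apply: (in_ideal_eval _ Zv); apply: coloop_compl_cover => I /cT -> //.
Qed.
End MomentFibre.

(** * Ranks and dimension *)

Section Ranks.
Variables (K : fieldType) (n r : nat) (S : 'M[K]_(n, r)).
Implicit Types I : {set 'I_n}.

Definition rows_of I : 'M[K]_(#|I|, r) :=
  rowsub (fun k : 'I_#|I| => enum_val k) S.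

Let sel I : 'M[K]_(#|I|, n) := rowsub (fun k : 'I_#|I| => enum_val k) 1%:M.

Lemma selE I k j : sel I k j = (enum_val k == j)%:R.
Proof. by rewrite !mxE. Qed.

Lemma sel_tr I : sel I *m (sel I)^T = 1%:M.
Proof.
apply/matrixP => k l; rewrite !mxE (bigD1 (enum_val l)) //= big1 ?addr0 => [|j njl].
  by rewrite !mxE eqxx mulr1 (inj_eq enum_val_inj).
by rewrite !mxE [_ l == j]eq_sym (negbTE njl) mulr0.
Qed.

(** Its row space consists of the left kernel vectors of S supported in I. *)
Let ker_on I := kermx (sel I *m S) *m sel I.

Lemma ker_on_sub I : (ker_on I <= kermx S)%MS.
Proof. by apply/sub_kermxP; rewrite -mulmxA mulmx_ker. Qed.

Lemma rank_ker_on I : \rank (ker_on I) = (#|I| - \rank (rows_of I))%N.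
Proof.
rewrite mxrankMfree; last by apply/row_freeP; exists (sel I)^T; apply: sel_tr.
by rewrite mxrank_ker /rows_of rowsubE.
Qed.

Lemma ker_on_full I : (kermx S <= ker_on I)%MS <-> coloop_compl S I.
Proof.
split=> [sub i niI|coc].
  apply/lam_eq0P => u /sub_kermxP /submx_trans /(_ sub) /submxP [w ->].
  rewrite mulmxA mxE big1 // => k _; rewrite selE.
  case: eqP => [ei|_]; last by rewrite mulr0.
  by move: niI; rewrite -ei enum_valP.
apply/row_subP => l; set u := row l _.
have u0 : u *m S = 0 by rewrite -row_mul mulmx_ker row0.
(* [(sel I)^T *m sel I] is the diagonal projector onto the coordinates in I, and u is supported
   there. *)
have uE : u = u *m (sel I)^T *m sel I.
  have selT : (sel I)^T *m sel I = diag_mx (\row_j (j \in I)%:R).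
    apply/matrixP => i j; rewrite !mxE; have [jI|njI] := boolP (j \in I).
      rewrite (bigD1 (enum_rank_in jI j)) //= big1 ?addr0 => [|k nk].
        by rewrite !mxE enum_rankK_in // eqxx mulr1 eq_sym; case: eqP => [->|]; rewrite ?jI.
      rewrite !mxE [X in _ * X](_ : _ = 0) ?mulr0 //; case: eqP => // e.
      by case/eqP: nk; apply: enum_val_inj; rewrite enum_rankK_in.
    rewrite big1 => [|k _].
      by case: eqP => [->|]; rewrite ?(negbTE njI).
    rewrite !mxE [X in _ * X](_ : _ = 0) ?mulr0 //; case: eqP => // e.
    by move: njI; rewrite -e enum_valP.
  rewrite -mulmxA selT; apply/rowP => j; rewrite mul_mx_diag [RHS]mxE [X in _ * X]mxE.
  have [_|njI] := boolP (j \in I); first by rewrite mulr1.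
  by rewrite mulr0 (proj1 (lam_eq0P S j) (coc j njI) u u0).
rewrite uE submxMr //; apply/sub_kermxP; rewrite mulmxA -uE //.
Qed.

(** Both sides say that the kernel vectors supported in I, of dimension #I - rk S_I, fill the left
    kernel, of dimension n - rk S. The ranks are bounded so that truncated subtraction is exact. *)
Lemma rank_coloop_compl I :
  (\rank S - \rank (rows_of I) = n - #|I|)%N <-> coloop_compl S I.
Proof.
rewrite -ker_on_full.
have [le_rk eq_rk] := mxrank_leqif_sup (ker_on_sub I).
rewrite -eq_rk rank_ker_on mxrank_ker.
have h1 : (\rank (rows_of I) <= \rank S)%N by rewrite /rows_of rowsubE mxrankM_maxr.
have h2 := rank_leq_row (rows_of I); have h3 := rank_leq_row S.
have h4 : (#|I| <= n)%N by rewrite -[n in (_ <= n)%N]card_ord max_card.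
by split=> [?|/eqP ?]; [apply/eqP|]; lia.
Qed.

(** Deleting one row lowers the rank by at most 1, and the previous lemma identifies a drop of
    exactly 1 with a coloop. *)
Lemma rank_delete_row i : \rank (rows_of [set~ i]) = \rank S <-> lam S i <> 0.
Proof.
have n0 : (0 < n)%N by apply: leq_ltn_trans (ltn_ord i).
have cI : #|[set~ i]| = n.-1 by rewrite cardsC1 card_ord.
have [le_rk _] := mxrank_leqif_sup (ker_on_sub [set~ i]).
have h1 : (\rank (rows_of [set~ i]) <= \rank S)%N by rewrite /rows_of rowsubE mxrankM_maxr.
have h2 := rank_leq_row (rows_of [set~ i]); have h3 := rank_leq_row S.
have coc : lam S i = 0 <-> coloop_compl S [set~ i].
  split=> [li0 j|]; first by rewrite !inE negbK => /eqP ->.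
  by apply; rewrite !inE eqxx.
rewrite rank_ker_on mxrank_ker in le_rk.
have := rank_coloop_compl [set~ i]; rewrite -coc => ranks.
split=> [eqr /ranks|nz]; first by lia.
by apply: NNPP => neq; apply: nz; apply/ranks; lia.
Qed.
End Ranks.

Section Dimension.
Variables (K : fieldType) (n r : nat) (S : 'M[K]_(n, r)).
Hypothesis infK : infinite_field K.
Local Notation m := (\rank (kermx S)).
Local Notation Z := (zeroset (moment_gen S)).

(** A right inverse of [ker_base] recovers t_j from the lam_l, up to the factor [zprod]. *)
Definition tcoord (j : 'I_m) : {mpoly K[n + n]} :=
  \sum_l pinvmx (ker_base S) l j *: @xy K n l.

Lemma chart_tcoord I j : tcoord j \Ps chart S I = tvar j * zprod S.
Proof.
rewrite /tcoord psubst_sum; set B := pinvmx _.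
transitivity ((\sum_l B l j *: lam S l) * zprod S).
  rewrite mulr_suml; apply: eq_bigr => l _.
  by rewrite linearZ /= chart_xy scalerAl.
congr (_ * _); transitivity (\sum_i (ker_base S *m B) i j *: tvar i).
  transitivity (\sum_l \sum_i (B l j * ker_base S i l) *: tvar i).
    by apply: eq_bigr => l _; rewrite scaler_sumr; apply: eq_bigr => i _; rewrite scalerA.
  rewrite exchange_big; apply: eq_bigr => i _; rewrite mxE scaler_suml.
  by apply: eq_bigr => l _; rewrite mulrC.
rewrite mulmxVp ?row_base_free // (bigD1 j) //= mxE eqxx scale1r big1 ?addr0 // => i nij.
by rewrite mxE (negbTE nij) scale0r.
Qed.

(** Only the first e variables stay free. The others become 1 rather than 0, so that products of the
    z_j remain nonzero. *)
Let freeze e (i : 'I_(n + m)) : {mpoly K[n + m]} := if (i < e)%N then 'X_i else 1.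
Let frozen e (v : 'I_(n + n)) := chart S setT v \Ps freeze e.

Lemma freeze_neq0 e i : freeze e i != 0.
Proof. by rewrite /freeze; case: ifP => _; rewrite ?oner_eq0 // -msupp_eq0 msuppX. Qed.

Lemma freeze_freeze e i : freeze e.+1 i \Ps freeze e = freeze e i.
Proof.
rewrite [freeze e.+1 i]/freeze ltnS; case: leqP => [ie|ei]; first by rewrite psubstX.
by rewrite rmorph1 /freeze ltnNge ltnW.
Qed.

(** Provides the functions that separate consecutive members of the chain below: they vanish once
    [X_e] is frozen, but not while it is free. *)
Lemma frozen_coordinate (e : 'I_(n + m)) : exists p : {mpoly K[n + n]},
  exists2 P : pred 'I_n, True & p \Ps chart S setT = ('X_e - 1) * \prod_(j | P j) zvar S j.
Proof.
rewrite -(splitK e); case: (split e) => i /=.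
  exists ('X_(lshift n i) - 1); exists pred0 => //.
  by rewrite big_pred0 // mulr1 rmorphB rmorph1 /= psubstX chartl inE.
exists (tcoord i - \prod_l 'X_(lshift n l)); exists predT => //.
rewrite -/(zprod S) mulrBl mul1r rmorphB rmorph_prod /= chart_tcoord; congr (_ - _).
by apply: eq_bigr => l _; rewrite psubstX chartl inE.
Qed.

Lemma moment_chain : has_chain Z (n + m).
Proof.
exists (fun e => image_closure (frozen e)); split=> [e _|e lte].
  split; [exact: image_closure_closed | exact: image_closure_irreducible |].
  by move=> v cv j; apply: cv; rewrite -psubst_comp chart_gen raddf0.
split=> [v cv p p0|sub].
  apply: cv; have : (p \Ps frozen e.+1) \Ps freeze e = 0 by rewrite p0 raddf0.
  rewrite -!psubst_comp => <-; rewrite [RHS]psubst_comp.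
  congr (comp_mpoly _ _); apply: eq_mktuple => i; rewrite freeze_freeze //.
have [p [P _ pE]] := frozen_coordinate (Ordinal lte).
have fE f : p \Ps frozen f = (freeze f (Ordinal lte) - 1) *
    \prod_(j | P j) freeze f (lshift m j).
  rewrite -psubst_comp pE rmorphM rmorphB rmorph1 /= psubstX rmorph_prod /=.
  by congr (_ * _); apply: eq_bigr => j _; rewrite psubstX.
have p0 : vanishes p (image_closure (frozen e)).
  by apply/(vanishes_image infK); rewrite fE /freeze /= ltnn subrr mul0r.
have /(vanishes_image infK)/eqP := vanishes_sub sub p0.
rewrite fE mulf_eq0 (negbTE (_ : \prod_(j | _) _ != 0)) ?orbF; last first.
  by apply/prodf_neq0 => j _; apply: freeze_neq0.
rewrite /freeze /= ltnSn => /eqP/(congr1 (meval (fun _ => 0))).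
by rewrite mevalB meval1 mevalXU meval0 sub0r => /eqP; rewrite oppr_eq0 oner_eq0.
Qed.

Lemma moment_dimension : dimension Z (n + m).
Proof.
split=> [|k [Y [Yi Ys]]]; first exact: moment_chain.
have [_ irrk subk] := Yi k (leqnn k).
have [I _ YI] := irreducible_in_chart_closure infK irrk subk.
by apply: (chain_bound (Y := Y) _ Ys YI) => i /Yi [].
Qed.

Lemma moment_complete_intersection : complete_intersection (moment_gen S).
Proof.
exists (n + m)%N, (\rank S^T); split; first exact: moment_dimension.
split; first by have := rank_leq_row S; rewrite mxrank_ker mxrank_tr; lia.
pose B := row_base S^T.
(* A basis of the column space of S gives rk S generators, which is the codimension 2n - (n + m). *)
exists (fun j => \sum_i B j i *: @xy K n i).
have lin (a b : nat) (A : 'M[K]_(a, n)) (C : 'M[K]_(b, n)) : (A <= C)%MS ->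
    forall j, in_ideal (fun j => \sum_i C j i *: @xy K n i) (\sum_i A j i *: @xy K n i).
  move=> /submxP [D ->] j.
  have -> : \sum_i (D *m C) j i *: @xy K n i = \sum_k D j k *: \sum_i C k i *: @xy K n i.
    transitivity (\sum_i \sum_k (D j k * C k i) *: @xy K n i).
      by apply: eq_bigr => i _; rewrite mxE scaler_suml.
    rewrite exchange_big; apply: eq_bigr => k _.
    by rewrite scaler_sumr; apply: eq_bigr => i _; rewrite scalerA.
  by apply: in_ideal_sum => k _; apply/in_idealZ/in_ideal_gen.
have genE j : moment_gen S j = \sum_i S^T j i *: @xy K n i.
  by apply: eq_bigr => i _; rewrite mxE.
split=> j; first by rewrite genE; apply: lin; rewrite eq_row_base.
apply: (@in_ideal_trans _ _ _ _ (fun j => \sum_i S^T j i *: @xy K n i)).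
  by move=> k; rewrite -genE; apply: in_ideal_gen.
by apply: lin; rewrite eq_row_base.
Qed.
End Dimension.

(** * Normality *)

Section RegularSequence.
Variables (K : fieldType) (n r : nat) (S : 'M[K]_(n, r)).
Hypothesis infK : infinite_field K.

(* Modulo x_i the scheme becomes the one of S extended by the column e_i, with
   the extra relation x_i = 0; the latter only meets charts where y_i is a
   parameter, so y_i is not a zero divisor. *)
Lemma regular_pair i (a b : {mpoly K[n + n]}) :
  in_ideal (moment_gen S) ('X_(rshift n i) * a - 'X_(lshift n i) * b) ->
  exists c, in_ideal (moment_gen S) (a - 'X_(lshift n i) * c).
Proof.
move=> id; pose S' : 'M[K]_(n, r + 1) := row_mx S (delta_mx i 0).
have genl j : moment_gen S' (lshift 1 j) = moment_gen S j.
  by apply: eq_bigr => k _; rewrite row_mxEl.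
have genr j : moment_gen S' (rshift r j) = @xy K n i.
  rewrite /moment_gen (bigD1 i) //= row_mxEr mxE eqxx ord1 eqxx scale1r.
  rewrite big1 ?addr0 // => k /negbTE nki; by rewrite row_mxEr mxE nki scale0r.
have li0 : lam S' i = 0.
  apply/lam_eq0P => u; rewrite mul_mx_row => /eqP; rewrite row_mx_eq0 => /andP[_ /eqP].
  move=> /(congr1 (fun w : 'M_1 => w 0 0)); rewrite !mxE (bigD1 i) //= mxE !eqxx mulr1.
  by rewrite big1 ?addr0 // => k /negbTE nki; rewrite mxE nki mulr0.
pose a0 := \sum_(e <- msupp a | e (lshift n i) == 0%N) a@_e *: 'X_[e].
pose a1 := \sum_(e <- msupp a | e (lshift n i) != 0%N) a@_e *: 'X_[e - U_(lshift n i)].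
have aE : a = a0 + 'X_(lshift n i) * a1.
  rewrite {1}(mpolyE a) (bigID (fun e : 'X_{1..n + n} => e (lshift n i) == 0%N)) /=.
  congr (_ + _); rewrite mulr_sumr; apply: eq_bigr => e ne0.
  by rewrite -scalerAr -mpolyXD addmC submK // lep1mP.
have a0_supp e : e \in msupp a0 -> e (lshift n i) = 0%N.
  rewrite mcoeff_msupp; apply: contraNeq => ne0; rewrite mcoeff_sum big1 // => e' /eqP e'0.
  rewrite mcoeffZ mcoeffX; case: (e' =P e) => [ee|]; last by rewrite mulr0.
  by rewrite -ee e'0 eqxx in ne0.
(* The monomials of [a0] are free of x_i, so [chart_for] leaves out i. Such a chart sends x_i to 0
   and y_i to z_i, and the given relation then kills [a0]. *)
have : in_ideal (moment_gen S') a0.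
  apply: (charts_cover infK) => k; rewrite mem_undup => /mapP [e /a0_supp e0 ->].
  set I := chart_for _ _.
  have iI : i \notin I by rewrite inE li0 eqxx reduced_partl e0.
  have xi0 : 'X_(lshift n i) \Ps chart S' I = 0.
    by rewrite psubstX chartl (negbTE iI) li0 mul0r.
  have id' : in_ideal (moment_gen S') ('X_(rshift n i) * a - 'X_(lshift n i) * b).
    by apply: in_ideal_trans id => j; rewrite -genl; apply: in_ideal_gen.
  have /eqP := chart_ideal I id'; rewrite rmorphB !rmorphM /= xi0 mul0r subr0.
  rewrite psubstX chartr (negbTE iI) mulf_eq0 (negbTE (zvar_neq0 _ _)) /= {1}aE.
  by rewrite rmorphD rmorphM /= xi0 mul0r addr0 => /eqP.
(* The coefficient of the extra generator x_i y_i in [a0] is absorbed into the multiple of x_i. *)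
move=> [c c0]; exists (a1 + 'X_(rshift n i) * c (rshift r ord0)).
have -> : a - 'X_(lshift n i) * (a1 + 'X_(rshift n i) * c (rshift r ord0)) =
          \sum_j c (lshift 1 j) * moment_gen S j.
  rewrite {1}aE c0 big_split_ord big_ord1 genr /=.
  under eq_bigr do rewrite genl.
  by rewrite /xy; ring.
by apply: in_ideal_sum => j _; apply/in_idealMl/in_ideal_gen.
Qed.
End RegularSequence.

Section Normality.
Variables (K : fieldType) (n r : nat) (S : 'M[K]_(n, r)).
Hypothesis infK : infinite_field K.
Local Notation m := (\rank (kermx S)).
Local Notation J := (moment_gen S).
Local Notation Z := (zeroset J).
Implicit Types (I : {set 'I_n}).

Lemma chart_eval0 I v : (chart S I v).@[fun _ => 0] = 0.
Proof.
have lam0 i : (lam S i).@[fun _ => 0] = 0.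
  by rewrite raddf_sum big1 // => j _; rewrite /= mevalZ mevalXU mulr0.
by rewrite /chart; case: split => i; case: ifP => _; rewrite ?mevalXU // mevalM lam0 mul0r.
Qed.

(** At a coloop i the local ring at the origin is not a domain: x_i y_i is zero, but each factor
    survives in some chart. The charts fix the origin, so no denominator nonzero there is killed by
    them. *)
Lemma normal_irreducible : normal_scheme J -> irreducible Z.
Proof.
move=> norm; apply/(moment_irreducible S infK) => i li0.
have Z0 : Z (fun _ => 0).
  by move=> j; rewrite raddf_sum big1 // => k _; rewrite /= mevalZ mevalM !mevalXU !mulr0.
have [dom _] := norm _ Z0.
have noz I v : chart S I v != 0 -> ~ zero_at J (fun _ => 0) 'X_v.
  move=> nz [w [nzw id]]; case/eqP: nzw.
  have /eqP := chart_ideal I id; rewrite rmorphM /= psubstX mulf_eq0 (negbTE nz) orbF.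
  move=> /eqP /(congr1 (meval (fun _ => 0))); rewrite meval0 psubst_eval => w0.
  by rewrite -[RHS]w0; apply: meval_eq => v'; rewrite chart_eval0.
have [||] := dom 'X_(lshift n i) 'X_(rshift n i).
- exists 1; rewrite meval1 oner_eq0 mul1r; split=> //.
  by apply: (coloop_compl_cover infK) => I _; rewrite -/(xy K i) chart_xy li0 mul0r.
- by apply: (noz setT); rewrite chartl inE zvar_neq0.
- by apply: (noz set0); rewrite chartr inE zvar_neq0.
Qed.

Hypothesis nz : forall i, lam S i <> 0.

(** Without coloops no monomial dies in any chart, so a single chart suffices in
    [in_ideal_of_charts]. *)
Lemma chart_inj I p : p \Ps chart S I = 0 <-> in_ideal J p.
Proof.
split=> [p0|]; last exact: chart_ideal.
apply: (in_ideal_of_charts infK) => k _; exists I => //.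
by apply: monom_chart_neq0 => i /nz.
Qed.

Lemma ideal_prime a b : in_ideal J (a * b) -> in_ideal J a \/ in_ideal J b.
Proof.
move/(chart_inj setT)/eqP; rewrite rmorphM mulf_eq0.
by case/orP => /eqP /(chart_inj setT); [left | right].
Qed.

Lemma var_notin v : ~ in_ideal J 'X_v.
Proof.
rewrite -(splitK v); case: (split v) => i /=.
  by move/(chart_inj setT)/eqP; rewrite psubstX chartl inE (negbTE (zvar_neq0 _ _)).
by move/(chart_inj set0)/eqP; rewrite psubstX chartr inE (negbTE (zvar_neq0 _ _)).
Qed.

Lemma cancel_exp v k a : in_ideal J ('X_v ^+ k * a) -> in_ideal J a.
Proof.
elim: k => [|k IH]; first by rewrite mul1r.
by rewrite exprS -mulrA => /ideal_prime [/var_notin//|/IH].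
Qed.

(** Induction on the power of y_i, then on that of x_i; primality of the ideal cancels the factor
    x_i. *)
Lemma regular_pair_exp i k l a b :
  in_ideal J ('X_(rshift n i) ^+ l * a - 'X_(lshift n i) ^+ k * b) ->
  exists c, in_ideal J (a - 'X_(lshift n i) ^+ k * c).
Proof.
set x := 'X_(lshift n i); set y := 'X_(rshift n i).
have one l' a' b' : in_ideal J (y ^+ l' * a' - x * b') ->
    exists c, in_ideal J (a' - x * c).
  elim: l' a' b' => [|l' IH] a' b'; first by rewrite mul1r; exists b'.
  rewrite exprS -mulrA => /(regular_pair infK) [c id]; exact: IH id.
elim: k a b => [|k IH] a b; first by exists a; rewrite mul1r subrr; apply: in_ideal0.
rewrite exprS -mulrA => id; have [c id1] := one _ _ _ id.
have : in_ideal J (x * (y ^+ l * c - x ^+ k * b)).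
  have -> : x * (y ^+ l * c - x ^+ k * b) =
     (y ^+ l * a - x * (x ^+ k * b)) - y ^+ l * (a - x * c) by ring.
  by apply: in_idealB => //; apply: in_idealMl.
case/ideal_prime => [/var_notin//|/IH [c' id2]]; exists c'.
have -> : a - x * x ^+ k * c' = (a - x * c) + x * (c - x ^+ k * c') by ring.
by apply: in_idealD => //; apply: in_idealMl.
Qed.

(** * Denominators of a fraction in the coordinate ring *)

Section Divisibility.
Variables a b : {mpoly K[n + n]}.
Hypothesis nzb : ~ in_ideal J b.

(** The ideal of denominators of a / b modulo J. *)
Definition conductor s := exists e, in_ideal J (s * a - b * e).

Lemma conductor_mul s t : conductor s -> conductor (t * s).
Proof.
move=> [e id]; exists (t * e).
have -> : t * s * a - b * (t * e) = t * (s * a - b * e) by ring.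
exact: in_idealMl.
Qed.

(** The two numerators satisfy y^k e1 = x^k e2 modulo J, so regularity makes e1 divisible by x^k,
    and x^k can be cancelled. *)
Lemma conductor_pair i k s :
  conductor ('X_(lshift n i) ^+ k * s) -> conductor ('X_(rshift n i) ^+ k * s) ->
  conductor s.
Proof.
set x := 'X_(lshift n i); set y := 'X_(rshift n i).
move=> [e1 id1] [e2 id2].
have : in_ideal J (b * (y ^+ k * e1 - x ^+ k * e2)).
  have -> : b * (y ^+ k * e1 - x ^+ k * e2) =
    x ^+ k * (y ^+ k * s * a - b * e2) - y ^+ k * (x ^+ k * s * a - b * e1) by ring.
  by apply: in_idealB; apply: in_idealMl.
case/ideal_prime => // /regular_pair_exp [c id3]; exists c.
apply: (@cancel_exp (lshift n i) k); rewrite -/x.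
have -> : x ^+ k * (s * a - b * c) = (x ^+ k * s * a - b * e1) + b * (e1 - x ^+ k * c) by ring.
by apply: in_idealD => //; apply: in_idealMl.
Qed.

Definition sigma I i : {mpoly K[n + n]} :=
  if i \in I then 'X_(lshift n i) else 'X_(rshift n i).

Lemma chart_sigma I i : sigma I i \Ps chart S I = zvar S i.
Proof. by rewrite /sigma; case: ifP => iI; rewrite psubstX ?chartl ?chartr iI. Qed.

Lemma chart_sigma_prod I : (\prod_i sigma I i) \Ps chart S I = zprod S.
Proof. by rewrite rmorph_prod; apply: eq_bigr => i _; apply: chart_sigma. Qed.

(** The chart becomes surjective after inverting [zprod]: each z_i is the image of [sigma I i], and
    t_j times [zprod] that of [tcoord j]. *)
Lemma chart_localization I (e : {mpoly K[n + m]}) :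
  exists k e', zprod S ^+ k * e = e' \Ps chart S I.
Proof.
elim/mpoly_ring_ind: e => [c|v|e1 e2|e1 e2].
- by exists 0%N, c%:MP; rewrite mul1r comp_mpolyC.
- rewrite -(splitK v); case: (split v) => i /=.
    by exists 0%N, (sigma I i); rewrite mul1r chart_sigma.
  by exists 1%N, (tcoord i); rewrite chart_tcoord mulrC.
- move=> [k1 [f1 E1]] [k2 [f2 E2]]; pose s := \prod_i sigma I i.
  exists (k1 + k2)%N, (s ^+ k2 * f1 + s ^+ k1 * f2).
  by rewrite rmorphD !rmorphM !rmorphXn /= chart_sigma_prod -E1 -E2 exprD; ring.
- move=> [k1 [f1 E1]] [k2 [f2 E2]]; exists (k1 + k2)%N, (f1 * f2).
  by rewrite rmorphM /= -E1 -E2 exprD; ring.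
Qed.

Lemma chart_conductor I e : a \Ps chart S I = (b \Ps chart S I) * e ->
  exists k, conductor ((\prod_i sigma I i) ^+ k).
Proof.
have [k [f fE]] := chart_localization I e => aE; exists k, f; apply/(chart_inj I).
rewrite rmorphB !rmorphM rmorphXn /= chart_sigma_prod aE -fE.
by ring.
Qed.

Lemma divisible_of_charts :
  (forall I, exists e, a \Ps chart S I = (b \Ps chart S I) * e) -> conductor 1.
Proof.
move=> h.
have /fin_all_exists [k0 Hk0] : forall I : {set 'I_n}, exists k,
    conductor ((\prod_i sigma I i) ^+ k).
  by move=> I; have [e /chart_conductor] := h I.
pose k := \max_I k0 I.
have cI I : conductor ((\prod_i sigma I i) ^+ k).
  by rewrite -(subnK (leq_bigmax I : (k0 I <= k)%N)) exprD; apply: conductor_mul.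
(* Factors are removed from the last index down. The sets with and without l put both x_l^k s and
   y_l^k s in the conductor, so [conductor_pair] removes the l-th factor. *)
suff step j : (j <= n)%N -> forall I, conductor ((\prod_(i < n | (i < n - j)%N) sigma I i) ^+ k).
  by have := step n (leqnn n) set0; rewrite subnn big_pred0 // expr1n.
elim: j => [_ I|j IH ltj I].
  by rewrite (eq_bigl predT) // => i; rewrite subn0 ltn_ord.
have ltn' : (n - j.+1 < n)%N by lia.
pose l := Ordinal ltn'.
have split_l I' : \prod_(i < n | (i < n - j)%N) sigma I' i =
    sigma I' l * \prod_(i < n | (i < n - j.+1)%N) sigma I' i.
  rewrite (bigD1 l) /=; last by lia.
  by congr (_ * _); apply: eq_bigl => i; rewrite -val_eqE /=; lia.
have same I' : (forall i : 'I_n, (i < n - j.+1)%N -> (i \in I') = (i \in I)) ->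
    \prod_(i < n | (i < n - j.+1)%N) sigma I' i = \prod_(i < n | (i < n - j.+1)%N) sigma I i.
  by move=> eqI; apply: eq_bigr => i /eqI; rewrite /sigma => ->.
apply: (@conductor_pair l k).
  have := IH (ltnW ltj) (l |: I); rewrite split_l same; last first.
    by move=> i lti; rewrite !inE -val_eqE /= ltn_eqF.
  by rewrite /sigma !inE eqxx exprMn.
have := IH (ltnW ltj) (I :\ l); rewrite split_l same; last first.
  by move=> i lti; rewrite !inE -val_eqE /= ltn_eqF.
by rewrite /sigma !inE eqxx exprMn.
Qed.
End Divisibility.

(** J is prime, so the coordinate ring embeds in its local rings. *)
Lemma zero_at_ideal p a : Z p -> zero_at J p a <-> in_ideal J a.
Proof.
move=> Zp; split=> [[w [nzw /ideal_prime [idw|//]]]|id].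
  by rewrite (in_ideal_eval idw Zp) eqxx in nzw.
by exists 1; rewrite meval1 oner_eq0 mul1r.
Qed.

Lemma irreducible_normal : normal_scheme J.
Proof.
move=> p Zp; split=> [a b|a b s d c].
  by rewrite !(zero_at_ideal _ Zp); apply: ideal_prime.
rewrite (zero_at_ideal _ Zp) => nzb nzs id.
have [d0|d_gt0] := posnP d.
  move: id; rewrite d0 big_ord0 addr0 mulr1 => /in_ideal_eval /(_ Zp) s0.
  by rewrite s0 eqxx in nzs.
(* Multiplying the equation by s^(d-1) makes it monic in s a. In each chart it lives in a polynomial
   ring, so b divides s a there. *)
have [e id'] : conductor (s * a) b 1.
  apply: divisible_of_charts => // I.
  apply: (integral_dvd (@mpoly_cic K _) (d := d)
            (c := fun k => (c k * s ^+ (d.-1 - k)) \Ps chart S I)).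
    by apply/eqP => /(chart_inj I).
  have E0 : (s ^+ d.-1 * (s * a ^+ d + \sum_(k < d) c k * a ^+ k * b ^+ (d - k)))
      \Ps chart S I = 0 by rewrite rmorphM /= (chart_ideal I id) mulr0.
  rewrite -[RHS]E0.
  rewrite mulrDr mulrA -exprSr prednK // -exprMn mulr_sumr rmorphD /= psubst_sum rmorphXn.
  congr (_ + _); apply: eq_bigr => k _.
  have -> : s ^+ d.-1 * (c k * a ^+ k * b ^+ (d - k)) =
            c k * s ^+ (d.-1 - k) * (s * a) ^+ k * b ^+ (d - k).
    have ltk := ltn_ord k; rewrite exprMn.
    have -> : s ^+ d.-1 = s ^+ (d.-1 - k) * s ^+ k by rewrite -exprD; congr (_ ^+ _); lia.
    by ring.
  by rewrite !(rmorphM, rmorphXn).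
exists e, s; split=> //; apply/(zero_at_ideal _ Zp).
by rewrite mul1r in id'.
Qed.
End Normality.

(** * Specialisation to the integral weight matrix *)

Theorem theorem2p2 (K : closedFieldType) (hK : [pchar K] =i pred0)
    (n r : nat) (S : 'M[int]_(n, r)) :
  let rkS := \rank (SK K S) in
  [/\ (* (i) *)
      radical_ideal (mu_comp K S) /\ complete_intersection (mu_comp K S)
        /\ dimension (mu0 K S) (n + n - rkS)%N,
      (* (ii) *)
      (forall Y : pset K (n + n),
         irr_component (mu0 K S) Y <->
         exists I : {set 'I_n},
           (rkS - rk_rows K S I = n - #|I|)%N /\
           (forall v, Y v <-> zclosure (mu0_J K S I) v)),
      (* (iii) *)
      (irreducible (mu0 K S) <->
         forall i : 'I_n, rk_rows K S [set~ i] = rkS) &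
      (* (iv) *)
      (normal_scheme (mu_comp K S) <-> irreducible (mu0 K S))].
Proof.
have infK := @closed_infinite K.
have muE : mu_comp K S = moment_gen (SK K S).
  apply: functional_extensionality => j; apply: eq_bigr => i _.
  by rewrite mxE.
have stratumE I : mu0_J K S I = stratum (SK K S) I by rewrite /mu0_J /mu0 muE.
rewrite /mu0 muE /=; split.
- split; first exact: moment_radical.
  split; first exact: moment_complete_intersection.
  have -> : (n + n - \rank (SK K S) = n + \rank (kermx (SK K S)))%N.
    by have := rank_leq_row (SK K S); rewrite mxrank_ker; lia.
  exact: moment_dimension.
- move=> Y; rewrite (moment_components _ infK).
  split=> -[I [cI YE]]; exists I; rewrite stratumE in YE *; split=> //.
    exact/rank_coloop_compl.
  exact/rank_coloop_compl.
- rewrite (moment_irreducible _ infK).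
  by split=> h i; have := rank_delete_row (SK K S) i; case=> rd dr;
     [exact/dr/h | exact/rd/h].
- split; first exact: normal_irreducible.
  by move/(moment_irreducible _ infK); apply: irreducible_normal.
Qed.
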